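(* Let $X,Y\in 2^\omega$ both be higher Martin-Löf random. Suppose that $X\le_{\omega_1^{\mathrm{ck}}\mathrm{T}} Y$ and that $Y$ is in fact strongly $\Pi^1_1$-Martin-Löf random. Then $X$ is also strongly $\Pi^1_1$-Martin-Löf random.
   Context: $\omega_1^{\mathrm{ck}}$ is the least non-computable ordinal. A set of natural numbers (or of finite binary strings) is higher c.e. if it is $\Pi^1_1$. A functional is a set $\Phi$ of pairs $(\tau,\sigma)$ of finite binary strings (no consistency requirement is imposed); for $X\in 2^{\le\omega}$, $\Phi(X)=\bigcup\{\sigma : (\tau,\sigma)\in\Phi \text{ for some } \tau\preceq X\}$. We write $X\le_{\omega_1^{\mathrm{ck}}\mathrm{T}} Y$ (higher Turing reducibility) if $\Phi(Y)=X$ for some $\Pi^1_1$ functional $\Phi$. A higher effectively open set is a set of the form $\bigcup_{\sigma\in B}[\sigma]$ with $B$ a $\Pi^1_1$ set of strings; a sequence of such sets is uniform if the generating sets $B_n$ are uniformly $\Pi^1_1$. A higher Martin-Löf test is a uniform sequence $(U_n)$ of higher effectively open sets with $\lambda(U_n)\le 2^{-n}$ ($\lambda$ the Lebesgue measure); $X$ is higher Martin-Löf random ($\Pi^1_1$-ML-random) if $X\notin\bigcap_n U_n$ for every such test. $X$ is strongly $\Pi^1_1$-ML-random (higher weakly 2-random) if $X\notin\bigcap_n U_n$ for every uniform sequence $(U_n)$ of higher effectively open sets with $\lambda(\bigcap_n U_n)=0$. *)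

(* Defs.v *)
From mathcomp Require Import all_boot all_order all_algebra.
From mathcomp Require Import all_classical all_reals all_analysis.
From mathcomp Require Import lra zify.

Set Implicit Arguments.
Unset Strict Implicit.
Unset Printing Implicit Defensive.

Import Order.TTheory GRing.Theory Num.Theory.
Import numFieldNormedType.Exports.

Local Open Scope classical_set_scope.
Local Open Scope nat_scope.

(* Arithmetical formulas (all quantifiers range over numbers) in the language
   of second-order arithmetic with a single free function variable, applied by
   [TFun].  Number variables are de Bruijn indices. *)
Inductive tm : Type :=
| TVar of nat
| TZero
| TSucc of tm
| TAdd of tm & tm
| TMul of tm & tm
| TFun of tm.

Inductive fm : Type :=
| FEq of tm & tm
| FNot of fm
| FAnd of fm & fm
| FOr of fm & fm
| FAll of fm
| FEx of fm.

(* Indices outside the environment evaluate to 0, so formulas have no hidden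
   number parameters. *)
Fixpoint teval (f : nat -> nat) (e : seq nat) (t : tm) : nat :=
  match t with
  | TVar i => nth 0 e i
  | TZero => 0
  | TSucc t1 => (teval f e t1).+1
  | TAdd t1 t2 => teval f e t1 + teval f e t2
  | TMul t1 t2 => teval f e t1 * teval f e t2
  | TFun t1 => f (teval f e t1)
  end.

Fixpoint sat (f : nat -> nat) (e : seq nat) (p : fm) : Prop :=
  match p with
  | FEq t1 t2 => teval f e t1 = teval f e t2
  | FNot p1 => ~ sat f e p1
  | FAnd p1 p2 => sat f e p1 /\ sat f e p2
  | FOr p1 p2 => sat f e p1 \/ sat f e p2
  | FAll p1 => forall n, sat f (n :: e) p1
  | FEx p1 => exists n, sat f (n :: e) p1
  end.

(* [enc x] is the tuple of natural numbers that represents [x]. *)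
Definition Pi11 (T : Type) (enc : T -> seq nat) (A : set T) : Prop :=
  exists p : fm, forall x, A x <-> forall f : nat -> nat, sat f (enc x) p.

Notation str := (seq bool).
Notation cantor := (nat -> bool).

(* Bijective base-2 numeration, least significant digit first, the bits
   [false] and [true] standing for the digits 1 and 2. *)
Fixpoint code (s : str) : nat :=
  match s with
  | [::] => 0
  | b :: s' => 2 * code s' + (1 + b)
  end.

Lemma code_inj : injective code.
Proof.
by elim=> [|b s IH] [|b' s'] //=; try lia; case: b b' => [] [] h;
  try lia; congr cons; apply: IH; lia.
Qed.

Lemma code_surj n : exists s, code s = n.
Proof.
elim/ltn_ind: n => -[|n] IH; first by exists [::].
have [|s sE] := IH n./2; first by lia.
by exists (odd n :: s) => /=; rewrite sE; lia.
Qed.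

Definition enc_nat_str (p : nat * str) : seq nat := [:: p.1; code p.2].
Definition enc_str_str (p : str * str) : seq nat := [:: code p.1; code p.2].

Definition initial (s : str) (X : cantor) : Prop :=
  forall i, i < size s -> nth false s i = X i.

Definition cylinder (s : str) : set cantor := [set X | initial s X].

Definition str_graph (s : str) : set (nat * bool) :=
  [set p | p.1 < size s /\ nth false s p.1 = p.2].

Definition cantor_graph (X : cantor) : set (nat * bool) :=
  [set p | X p.1 = p.2].

(* Phi(Y), a union of strings seen as finite partial functions.  As Phi need
   not be consistent, the result is in general only a relation. *)
Definition fun_app (Phi : set (str * str)) (Y : cantor) : set (nat * bool) :=
  \bigcup_(p in [set p | Phi p /\ initial p.1 Y]) str_graph p.2.

Definition higher_Turing_le (X Y : cantor) : Prop :=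
  exists Phi : set (str * str),
    Pi11 enc_str_str Phi /\ fun_app Phi Y = cantor_graph X.

Definition binary_digits (R : realType) (x : R) : cantor :=
  fun n => odd (Num.truncn (x * 2 ^+ n.+1)%R).

(* The image of Lebesgue measure on [0, 1[ under binary expansion. *)
Definition lambda (R : realType) (A : set cantor) : \bar R :=
  lebesgue_measure (`[0%R, 1%R[ `&` @binary_digits R @^-1` A).

(* Big-endian value, used to locate the dyadic interval of a string. *)
Definition bval (s : str) : nat := foldl (fun m (b : bool) => m.*2 + b) 0 s.

Lemma initial_rcons s b X :
  initial (rcons s b) X <-> initial s X /\ X (size s) = b.
Proof.
split=> [h|[h hb] i].
  split=> [i si|].
    have := h i; rewrite size_rcons nth_rcons si; apply.
    exact: ltnW.
  have := h (size s); rewrite size_rcons nth_rcons ltnn eqxx => <- //.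
rewrite size_rcons ltnS leq_eqVlt nth_rcons => /orP[/eqP ->|si].
  by rewrite ltnn eqxx.
by rewrite si h.
Qed.

Lemma bval_rcons s b : bval (rcons s b) = (bval s).*2 + b.
Proof. by rewrite /bval -cats1 foldl_cat. Qed.

Lemma bval_lt s : bval s < 2 ^ size s.
Proof.
elim/last_ind: s => // s b IH.
by rewrite bval_rcons size_rcons expnS; case: b; lia.
Qed.

Section lambda_theory.
Local Open Scope ring_scope.

Lemma truncn_half (R : realType) (y : R) : 0 <= y ->
  Num.truncn (y * 2) = ((Num.truncn y).*2 + odd (Num.truncn (y * 2)))%N.
Proof.
move=> y0; suff : (Num.truncn (y * 2))./2 = Num.truncn y by lia.
have y20 : 0 <= y * 2 by lra.
have /andP[h1 h2] := truncn_itv y0.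
have l1 : ((Num.truncn y).*2 <= Num.truncn (y * 2))%N.
  by rewrite truncn_ge_nat// -muln2 natrM; lra.
have l2 : (Num.truncn (y * 2) < (Num.truncn y).+1.*2)%N.
  by rewrite truncn_lt_nat// -muln2 natrM; lra.
by lia.
Qed.

Lemma initial_binary_digits (R : realType) (s : str) (x : R) :
  0 <= x < 1 ->
  initial s (binary_digits x) <-> Num.truncn (x * 2 ^+ size s) = bval s.
Proof.
move=> x01; have x0 : 0 <= x by case/andP: x01.
elim/last_ind: s => [|s b IH].
  split=> //= _; rewrite expr0 mulr1 /bval /=.
  by apply: truncn_def; lra.
rewrite initial_rcons IH size_rcons bval_rcons /binary_digits exprSr mulrA.
have := @truncn_half R (x * 2 ^+ size s) (mulr_ge0 x0 (exprn_ge0 _ (ler0n _ _))).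
by case: b; case: odd; split=> [[]|]; lia.
Qed.

Lemma lambda_cylinder (R : realType) (s : str) :
  lambda R (cylinder s) = ((2 ^- size s)%R)%:E.
Proof.
rewrite /lambda.
have p0 : 0 < 2 ^+ size s :> R by rewrite exprn_gt0.
pose a : R := (bval s)%:R / 2 ^+ size s.
pose b : R := (bval s).+1%:R / 2 ^+ size s.
have vE : (bval s).+1%:R <= 2 ^+ size s :> R.
  by rewrite -natrX ler_nat bval_lt.
have E : `[0, 1[ `&` @binary_digits R @^-1` cylinder s = `[a, b[%classic.
  apply/seteqP; split=> x /=; rewrite !in_itv /=.
    move=> [x01 /(initial_binary_digits _ x01) h].
    have x0 : 0 <= x * 2 ^+ size s by rewrite mulr_ge0 ?exprn_ge0//; lra.
    have := truncn_itv x0.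
    by rewrite h /a /b ler_pdivrMr// ltr_pdivlMr.
  rewrite /a /b ler_pdivrMr// ltr_pdivlMr// => h.
  have x01 : 0 <= x < 1.
    apply/andP; split.
      rewrite -(pmulr_lge0 _ p0); apply: le_trans (_ : (bval s)%:R <= _).
        exact: ler0n.
      by case/andP: h.
    rewrite -(ltr_pM2r p0) mul1r; case/andP: h => _ h.
    exact: lt_le_trans h vE.
  by split=> //; apply/(initial_binary_digits _ x01); apply: truncn_def.
rewrite E.
have ab : a < b by rewrite /a /b ltr_pM2r ?invr_gt0// ltr_nat.
rewrite lebesgue_measure_itv /= lte_fin ab -EFinD /a /b -mulrBl.
by rewrite -natr1 addrAC subrr add0r mul1r.
Qed.

End lambda_theory.

Definition uniform_higher_open (U : nat -> set cantor) : Prop :=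
  exists B : nat -> set str,
    Pi11 enc_nat_str [set p | B p.1 p.2] /\
    forall n, U n = \bigcup_(s in B n) cylinder s.

Definition higher_ML_test (R : realType) (U : nat -> set cantor) : Prop :=
  uniform_higher_open U /\
  forall n, (lambda R (U n) <= ((2 ^- n)%R)%:E)%E.

Definition higher_ML_random (R : realType) (X : cantor) : Prop :=
  forall U, higher_ML_test R U -> ~ (\bigcap_n U n) X.

Definition strongly_Pi11_ML_random (R : realType) (X : cantor) : Prop :=
  forall U, uniform_higher_open U -> lambda R (\bigcap_n U n) = 0%E ->
    ~ (\bigcap_n U n) X.

(* Main.v *)
(* Write Phi as a family of axioms x = (tau_x, sigma_x) carrying a norm <= whose
   initial segments are Delta^1_1, uniformly in the bounding axiom.
   (1) From [tau_x] remove, up to a tiny part, the open set W_x of the oracles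
   extending tau_y for some y <= x with sigma_y incompatible with sigma_x.  The thinned
   axioms Psi still compute X from Y, and if A_s is the set of oracles on which an
   axiom of Psi outputs an extension of s, then A_s is, up to measure 2^-|s|,
   contained in a set B_s, the B_s being disjoint for incompatible s.  So the s with
   lambda(A_s) > (2^n + 1) 2^-|s| generate an open set of measure at most 2^-n, and,
   X being ML-random, lambda(A_s) <= c 2^-|s| for some c and all s on X.
   (2) Keep an axiom z of Psi only if the axioms below z obey that bound for all
   prefixes of sigma_z.  No axiom used by Y is lost, and now lambda(A_s) <= c 2^-|s|
   for all s, so the inverse image of a null intersection of higher open sets is a
   null intersection of higher open sets. *)

Require Import Defs.
From mathcomp Require Import all_boot all_order all_algebra.
From mathcomp Require Import all_classical all_reals all_analysis.
From mathcomp Require Import ring lra zify.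
Import Defs.

Set Implicit Arguments.
Unset Strict Implicit.
Unset Printing Implicit Defensive.

Import Order.TTheory GRing.Theory Num.Theory.

Local Open Scope classical_set_scope.
Local Open Scope nat_scope.

(** For ordinary Turing functionals only finitely many axioms precede a given one, so the oracles on
    which they contradict it form a clopen set, which can be removed exactly. Here infinitely many
    axioms $y\le x$ may precede $x$; the complement of the open set $W_x$ need not be open, and only
    a clopen part of $W_x$ can be removed. The leftovers are made so small that, over all axioms
    with output extending $s$, they add up to at most $2^{-|s|}$: this is the $+1$ in $2^n+1$. The
    axioms used by $Y$ survive because $\Phi(Y)=X$: no axiom with a conflicting output applies to
    $Y$, so $Y\notin W_x$. Both constructions have to stay $\Pi^1_1$. The statement $\lambda(A)>q$
    is $\Pi^1_1$ when $A$ is generated by a $\Pi^1_1$ set of strings, and $\lambda(A)\le q$ is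
    $\Pi^1_1$ when $A$ is generated by a $\Sigma^1_1$ set. The second fact is why tests may only
    speak of the axioms below a given one, an initial segment of the norm being also $\Sigma^1_1$.
    In (2) these local tests bound all of $A_s$, since a finite nonempty set of kept axioms has a
    largest member, whose own test covers the set. *)

(** * Arithmetical and Pi^1_1 predicates *)

(* Environments as total functions: variables can then be renamed freely. *)
Definition scons (n : nat) (e : nat -> nat) : nat -> nat :=
  fun i => if i is j.+1 then e j else n.

Fixpoint tevalf (f e : nat -> nat) (t : tm) : nat :=
  match t with
  | TVar i => e i
  | TZero => 0
  | TSucc t1 => (tevalf f e t1).+1
  | TAdd t1 t2 => tevalf f e t1 + tevalf f e t2
  | TMul t1 t2 => tevalf f e t1 * tevalf f e t2
  | TFun t1 => f (tevalf f e t1)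
  end.

Fixpoint satf (f e : nat -> nat) (p : fm) : Prop :=
  match p with
  | FEq t1 t2 => tevalf f e t1 = tevalf f e t2
  | FNot p1 => ~ satf f e p1
  | FAnd p1 p2 => satf f e p1 /\ satf f e p2
  | FOr p1 p2 => satf f e p1 \/ satf f e p2
  | FAll p1 => forall n, satf f (scons n e) p1
  | FEx p1 => exists n, satf f (scons n e) p1
  end.

Lemma nth_scons n s : nth 0 (n :: s) = scons n (nth 0 s).
Proof. by apply/funext => -[]. Qed.

Lemma tevalfE f s t : teval f s t = tevalf f (nth 0 s) t.
Proof. by elim: t => //= [t ->|t -> u ->|t -> u ->|t ->]. Qed.

Lemma satfE f s p : sat f s p <-> satf f (nth 0 s) p.
Proof.
elim: p s => [t u|p IH|p IHp q IHq|p IHp q IHq|p IH|p IH] s /=.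
- by rewrite !tevalfE.
- by rewrite IH.
- by rewrite IHp IHq.
- by rewrite IHp IHq.
- by split=> H n; have := H n; rewrite IH nth_scons.
- by split=> -[n H]; exists n; move: H; rewrite IH nth_scons.
Qed.

Notation ctxp := ((nat -> nat) -> (nat -> nat) -> Prop).
Notation ctxf := ((nat -> nat) -> (nat -> nat) -> nat).

Definition Tm (t : ctxf) := exists T, forall g e, t g e = tevalf g e T.
Definition Ar (P : ctxp) := exists p, forall g e, P g e <-> satf g e p.
(* [t] has an arithmetical graph: [e 0] is its value, the rest of [e] its context. *)
Definition Fn (t : ctxf) := Ar (fun g e => t g (fun i => e i.+1) = e 0).

Lemma ar_iff P Q : (forall g e, P g e <-> Q g e) -> Ar P -> Ar Q.
Proof. by move=> PQ [p pP]; exists p => g e; rewrite -PQ pP. Qed.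

Lemma ar_eqt t u : Tm t -> Tm u -> Ar (fun g e => t g e = u g e).
Proof. by move=> [T tT] [U uU]; exists (FEq T U) => g e; rewrite tT uU. Qed.

Lemma ar_not P : Ar P -> Ar (fun g e => ~ P g e).
Proof. by move=> [p pP]; exists (FNot p) => g e /=; rewrite pP. Qed.

Lemma ar_and P Q : Ar P -> Ar Q -> Ar (fun g e => P g e /\ Q g e).
Proof. by move=> [p pP] [q qQ]; exists (FAnd p q) => g e /=; rewrite pP qQ. Qed.

Lemma ar_or P Q : Ar P -> Ar Q -> Ar (fun g e => P g e \/ Q g e).
Proof. by move=> [p pP] [q qQ]; exists (FOr p q) => g e /=; rewrite pP qQ. Qed.

Lemma ar_all (P : (nat -> nat) -> (nat -> nat) -> nat -> Prop) :
  Ar (fun g e => P g (fun i => e i.+1) (e 0)) -> Ar (fun g e => forall n, P g e n).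
Proof.
move=> [p pP]; exists (FAll p) => g e /=.
by split=> H n; have := H n; rewrite -(pP g (scons n e)).
Qed.

Lemma ar_ex (P : (nat -> nat) -> (nat -> nat) -> nat -> Prop) :
  Ar (fun g e => P g (fun i => e i.+1) (e 0)) -> Ar (fun g e => exists n, P g e n).
Proof.
move=> [p pP]; exists (FEx p) => g e /=.
by split=> -[n H]; exists n; move: H; rewrite -(pP g (scons n e)).
Qed.

Lemma ar_imp P Q : Ar P -> Ar Q -> Ar (fun g e => P g e -> Q g e).
Proof.
move=> hP hQ; apply: ar_iff (ar_or (ar_not hP) hQ) => g e.
by split=> [[]//|PQ]; have [/PQ|] := EM (P g e); [right|left].
Qed.

Lemma tm_var i : Tm (fun g e => e i).
Proof. by exists (TVar i). Qed.

Lemma tm_fun t : Tm t -> Tm (fun g e => g (t g e)).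
Proof. by move=> [T tT]; exists (TFun T) => g e /=; rewrite tT. Qed.

Lemma ar_ren (rho : nat -> nat) P : Ar P -> Ar (fun g e => P g (fun i => e (rho i))).
Proof.
move=> [p pP].
apply: (@ar_iff (fun g e => satf g (fun i => e (rho i)) p)).
  by move=> g e; rewrite pP.
(* The inner [scons] builds a renaming, not an environment: it fixes the variable 0 bound by the
   quantifier and shifts the rest. *)
have lift (r : nat -> nat) n e :
    scons n (fun i => e (r i)) = fun i => scons n e (scons 0 (fun i => (r i).+1) i).
  by apply/funext => -[].
elim: p rho {P pP} => [t u|p IH|p IHp q IHq|p IHp q IHq|p IH|p IH] rho /=.
- have tr s : Tm (fun g e => tevalf g (fun i => e (rho i)) s).
    elim: s => [i||s [S hS]|s [S hS] s' [S' hS']|s [S hS] s' [S' hS']|s [S hS]].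
    + exact: tm_var.
    + by exists TZero.
    + by exists (TSucc S) => g e /=; rewrite hS.
    + by exists (TAdd S S') => g e /=; rewrite hS hS'.
    + by exists (TMul S S') => g e /=; rewrite hS hS'.
    + by exists (TFun S) => g e /=; rewrite hS.
  exact: ar_eqt.
- exact: ar_not.
- exact: ar_and.
- exact: ar_or.
- have [q hq] := IH (scons 0 (fun i => (rho i).+1)).
  by exists (FAll q) => g e /=; split=> H n; move: (H n); rewrite (lift rho n e) -(hq g (scons n e)).
- have [q hq] := IH (scons 0 (fun i => (rho i).+1)).
  exists (FEx q) => g e /=.
  by split=> -[n H]; exists n; move: H; rewrite (lift rho n e) -(hq g (scons n e)).
Qed.

Lemma tm_shift t : Tm t -> Tm (fun g e => t g (fun i => e i.+1)).
Proof.
move=> [T hT].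
suff [S hS] : Tm (fun g e => tevalf g (fun i => e i.+1) T).
  by exists S => g e; rewrite hT hS.
elim: T {t hT} => [i||s [S hS]|s [S hS] s' [S' hS']|s [S hS] s' [S' hS']|s [S hS]].
- exact: tm_var.
- by exists TZero.
- by exists (TSucc S) => g e /=; rewrite hS.
- by exists (TAdd S S') => g e /=; rewrite hS hS'.
- by exists (TMul S S') => g e /=; rewrite hS hS'.
- by exists (TFun S) => g e /=; rewrite hS.
Qed.

Lemma fn_tm t : Tm t -> Fn t.
Proof. by move=> /tm_shift ht; apply: ar_eqt ht (tm_var 0). Qed.

Lemma fn_shift t : Fn t -> Fn (fun g e => t g (fun i => e i.+1)).
Proof. exact: (ar_ren (fun i => if i is j.+1 then i.+1 else 0)). Qed.

(** The value of [t] is introduced by an existential quantifier, so an arithmetical graph is enough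
    and [t] need not be a term of the language. *)
Lemma ar1 (R : nat -> Prop) t :
  Ar (fun g e => R (e 0)) -> Fn t -> Ar (fun g e => R (t g e)).
Proof.
move=> hR ht; apply: (@ar_iff (fun g e => exists n, t g e = n /\ R n)).
  by move=> g e; split=> [[n [->]]//|]; exists (t g e).
by apply: ar_ex; apply: ar_and ht hR.
Qed.

Lemma ar2 (R : nat -> nat -> Prop) t u :
  Ar (fun g e => R (e 0) (e 1)) -> Fn t -> Fn u ->
  Ar (fun g e => R (t g e) (u g e)).
Proof.
move=> hR ht hu.
apply: (@ar_iff (fun g e => exists n, t g e = n /\ exists m, u g e = m /\ R n m)).
  move=> g e; split=> [[n [-> [m [->]]]]//|h].
  by exists (t g e); split=> //; exists (u g e).
apply: ar_ex; apply: ar_and ht _; apply: ar_ex.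
apply: ar_and; first exact: (fn_shift hu).
exact: (ar_ren (fun i => if i is 0 then 1 else 0) hR).
Qed.

Lemma ar3 (R : nat -> nat -> nat -> Prop) t u v :
  Ar (fun g e => R (e 0) (e 1) (e 2)) -> Fn t -> Fn u -> Fn v ->
  Ar (fun g e => R (t g e) (u g e) (v g e)).
Proof.
move=> hR ht hu hv.
apply: (@ar_iff (fun g e => exists n, t g e = n /\ exists m, u g e = m /\
  exists k, v g e = k /\ R n m k)).
  move=> g e; split=> [[n [-> [m [-> [k [->]]]]]]//|h].
  by exists (t g e); split=> //; exists (u g e); split=> //; exists (v g e).
apply: ar_ex; apply: ar_and ht _; apply: ar_ex.
apply: ar_and; first exact: (fn_shift hu).
apply: ar_ex; apply: ar_and; first exact: (fn_shift (fn_shift hv)).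
exact: (ar_ren (fun i => 2 - i) hR).
Qed.

Lemma fn1 (h : nat -> nat) t :
  Ar (fun g e => h (e 1) = e 0) -> Fn t -> Fn (fun g e => h (t g e)).
Proof.
move=> hh ht; apply: (@ar2 (fun a b => h a = b)).
- exact: (ar_ren (fun i => 1 - i) hh).
- exact: fn_shift.
- exact: fn_tm (tm_var 0).
Qed.

Lemma fn2 (h : nat -> nat -> nat) t u :
  Ar (fun g e => h (e 1) (e 2) = e 0) -> Fn t -> Fn u ->
  Fn (fun g e => h (t g e) (u g e)).
Proof.
move=> hh ht hu; apply: (@ar3 (fun a b c => h a b = c)).
- exact: (ar_ren (fun i => if i is j.+1 then j else 2) hh).
- exact: fn_shift.
- exact: fn_shift.
- exact: fn_tm (tm_var 0).
Qed.

Lemma fn3 (h : nat -> nat -> nat -> nat) t u v :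
  Ar (fun g e => h (e 1) (e 2) (e 3) = e 0) -> Fn t -> Fn u -> Fn v ->
  Fn (fun g e => h (t g e) (u g e) (v g e)).
Proof.
move=> hh ht hu hv.
apply: (@ar_iff (fun g e => exists n, t g (fun i => e i.+1) = n /\
  h n (u g (fun i => e i.+1)) (v g (fun i => e i.+1)) = e 0)).
  by move=> g e; split=> [[n [->]]//|]; eexists; split; first reflexivity.
apply: ar_ex; apply: ar_and; first exact: (fn_shift ht).
apply: (@ar_iff (fun g e => exists n, u g (fun i => e i.+2) = n /\
  h (e 0) n (v g (fun i => e i.+2)) = e 1)).
  by move=> g e; split=> [[n [->]]//|]; eexists; split; first reflexivity.
apply: ar_ex; apply: ar_and; first exact: (fn_shift (fn_shift hu)).
apply: (@ar_iff (fun g e => exists n, v g (fun i => e i.+3) = n /\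
  h (e 1) (e 0) n = e 2)).
  by move=> g e; split=> [[n [->]]//|]; eexists; split; first reflexivity.
apply: ar_ex; apply: ar_and; first exact: (fn_shift (fn_shift (fn_shift hv))).
exact: (ar_ren (fun i => nth 0 [:: 3; 2; 1; 0] i) hh).
Qed.

Lemma fn_var i : Fn (fun g e => e i).
Proof. exact: fn_tm (tm_var i). Qed.

Lemma fn_const n : Fn (fun g e => n).
Proof.
apply: fn_tm; elim: n => [|n [T hT]]; first by exists TZero.
by exists (TSucc T) => g e /=; rewrite -(hT g e).
Qed.

Lemma fn_fun t : Fn t -> Fn (fun g e => g (t g e)).
Proof.
move=> ht; apply: (@ar_iff (fun g e => exists n, t g (fun i => e i.+1) = n /\ g n = e 0)).
  by move=> g e; split=> [[n [->]]//|]; eexists; split; first reflexivity.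
apply: ar_ex; apply: ar_and; first exact: (fn_shift ht).
by apply: ar_eqt (tm_var 1); apply: tm_fun (tm_var 0).
Qed.

Lemma fn_S t : Fn t -> Fn (fun g e => (t g e).+1).
Proof. by apply: fn1; exists (FEq (TSucc (TVar 1)) (TVar 0)). Qed.

Lemma fn_add t u : Fn t -> Fn u -> Fn (fun g e => t g e + u g e).
Proof. by apply: fn2; exists (FEq (TAdd (TVar 1) (TVar 2)) (TVar 0)). Qed.

Lemma fn_mul t u : Fn t -> Fn u -> Fn (fun g e => t g e * u g e).
Proof. by apply: fn2; exists (FEq (TMul (TVar 1) (TVar 2)) (TVar 0)). Qed.

Lemma ar_eq t u : Fn t -> Fn u -> Ar (fun g e => t g e = u g e).
Proof. by apply: (@ar2 (fun a b => a = b)); apply: ar_eqt; apply: tm_var. Qed.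

Lemma ar_le t u : Fn t -> Fn u -> Ar (fun g e => t g e <= u g e).
Proof.
apply: (@ar2 (fun a b => a <= b)).
apply: (@ar_iff (fun g e => exists n, e 0 + n = e 1)).
  by move=> g e; split=> [[n]|h]; [lia|exists (e 1 - e 0); lia].
by apply: ar_ex; apply: ar_eq; [apply: fn_add; apply: fn_var|apply: fn_var].
Qed.

(** Excluded middle replaces a fixed proposition by a trivially true or a trivially false
    formula. *)
Lemma ar_const (p : Prop) : Ar (fun g e => p).
Proof.
have [hp|hp] := EM p; first by exists (FEq TZero TZero).
by exists (FNot (FEq TZero TZero)) => g e /=; split.
Qed.

Ltac ar_atom := fail.
Ltac fn_atom := fail.

Ltac ar_step := cbn beta;
  match goal with
  | |- Ar (fun g e => _ /\ _) => apply: ar_and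
  | |- Ar (fun g e => _ \/ _) => apply: ar_or
  | |- Ar (fun g e => ~ _) => apply: ar_not
  | |- Ar (fun g e => exists n : nat, _) => apply: ar_ex
  | |- Ar (fun g e => forall n : nat, _) => apply: ar_all
  | |- Ar (fun g e => _ -> _) => apply: ar_imp
  | |- Ar (fun g e => @eq nat _ _) => apply: ar_eq
  | |- Ar (fun g e => is_true (leq _ _)) => apply: ar_le
  | |- Fn (fun g e => e ?i) => apply: fn_var
  | |- Fn (fun g e => _.+1) => apply: fn_S
  | |- Fn (fun g e => _ + _) => apply: fn_add
  | |- Fn (fun g e => _ * _) => apply: fn_mul
  | |- Fn (fun g e => g _) => apply: fn_fun
  | |- Fn (fun g e => ?n) => apply: fn_const
  | h : _ |- Ar _ => simple apply h
  | h : _ |- Fn _ => simple apply h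
  | _ => ar_atom
  | _ => fn_atom
  end.
Ltac ar_auto := repeat ar_step.

Notation ctxF := ((nat -> nat) -> (nat -> nat) -> nat -> nat).

(* The same for function-valued [F]: [e 1] is the argument, [e 0] the value. *)
Definition Ff (F : ctxF) := Ar (fun g e => F g (fun i => e i.+2) (e 1) = e 0).

Lemma ff_shift F : Ff F -> Ff (fun g e => F g (fun i => e i.+1)).
Proof. exact: (ar_ren (fun i => if i is j.+2 then i.+1 else i)). Qed.

Lemma fn_app F t : Ff F -> Fn t -> Fn (fun g e => F g e (t g e)).
Proof.
move=> hF ht.
apply: (@ar_iff (fun g e => exists n, t g (fun i => e i.+1) = n /\
   F g (fun i => e i.+1) n = e 0)).
  by move=> g e; split=> [[n [->]]//|]; eexists; split; first reflexivity.
apply: ar_ex; apply: ar_and; first exact: (fn_shift ht).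
exact: (ar_ren (fun i => if i is j.+2 then i else 1 - i) hF).
Qed.

Lemma fn_tevalf F E t : (forall i, Fn (fun g e => E g e i)) -> Ff F ->
  Fn (fun g e => tevalf (F g e) (E g e) t).
Proof.
move=> hE hF; elim: t => [i||s hs|s hs u hu|s hs u hu|s hs] /=.
- exact: hE.
- exact: fn_const.
- exact: fn_S.
- exact: fn_add.
- exact: fn_mul.
- exact: fn_app.
Qed.

Lemma ar_satf F E p : (forall i, Fn (fun g e => E g e i)) -> Ff F ->
  Ar (fun g e => satf (F g e) (E g e) p).
Proof.
elim: p F E => [t u|p IH|p IHp q IHq|p IHp q IHq|p IH|p IH] F E hE hF /=.
- by apply: ar_eq; apply: fn_tevalf.
- by apply: ar_not; apply: IH.
- by apply: ar_and; [apply: IHp|apply: IHq].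
- by apply: ar_or; [apply: IHp|apply: IHq].
- apply: ar_all; apply: (IH (fun g e => F g (fun i => e i.+1))
    (fun g e => scons (e 0) (E g (fun i => e i.+1)))); last exact: ff_shift.
  by case=> [|i]; [exact: fn_var|exact: (fn_shift (hE i))].
- apply: ar_ex; apply: (IH (fun g e => F g (fun i => e i.+1))
    (fun g e => scons (e 0) (E g (fun i => e i.+1)))); last exact: ff_shift.
  by case=> [|i]; [exact: fn_var|exact: (fn_shift (hE i))].
Qed.

(** Simultaneous substitution for the number variables and for the function variable. It allows the
    single function symbol of a formula to be reinterpreted as a half, a row or a join of other
    functions. *)
Lemma ar_subst P F E : Ar P -> (forall i, Fn (fun g e => E g e i)) -> Ff F ->
  Ar (fun g e => P (F g e) (E g e)).
Proof.
move=> [p hp] hE hF; apply: ar_iff (ar_satf p hE hF) => g e.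
by rewrite -hp.
Qed.

(** * Coding of pairs and of finite sequences *)

(* A polynomial, hence a term of the language.  It is injective but not onto;
   [lp] and [rp] are [0] off its range. *)
Definition pr (a b : nat) := (a + b) * (a + b) + a.

(** [pr a b] lies between the squares of [a + b] and [a + b + 1], which determines the sum, and then
    [a]. *)
Lemma pr_inj a b c d : pr a b = pr c d -> a = c /\ b = d.
Proof.
rewrite /pr => h.
have h1 : a + b = c + d by nia.
by rewrite h1 in h; lia.
Qed.

Definition lp (c : nat) : nat := xget 0 [set a | exists b, c = pr a b].
Definition rp (c : nat) : nat := xget 0 [set b | exists a, c = pr a b].

Lemma lpK a b : lp (pr a b) = a.
Proof.
rewrite /lp; case: xgetP => [x _ [y /pr_inj[]//]|/(_ a)] /=.
by case; exists b.
Qed.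

Lemma rpK a b : rp (pr a b) = b.
Proof.
rewrite /rp; case: xgetP => [x _ [y /pr_inj[]//]|/(_ b)] /=.
by case; exists a.
Qed.

Lemma fn_pr t u : Fn t -> Fn u -> Fn (fun g e => pr (t g e) (u g e)).
Proof. by apply: fn2; rewrite /pr; ar_auto. Qed.

Lemma fn_lp t : Fn t -> Fn (fun g e => lp (t g e)).
Proof.
apply: fn1; apply: (@ar_iff (fun g e =>
    (exists b, e 1 = pr (e 0) b) \/ (~ (exists a b, e 1 = pr a b) /\ e 0 = 0))).
  move=> g e; split.
    case=> [[b ->]|[h ->]]; first by rewrite lpK.
    by rewrite /lp; case: xgetP => // x _ [b hb]; case: h; exists x, b.
  have [[a [b ->]]|h] := EM (exists a b, e 1 = pr a b).
    by rewrite lpK => <-; left; exists b.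
  move=> <-; right; split=> //.
  by rewrite /lp; case: xgetP => // x _ [b hb]; case: h; exists x, b.
by rewrite /pr; ar_auto.
Qed.

Lemma fn_rp t : Fn t -> Fn (fun g e => rp (t g e)).
Proof.
apply: fn1; apply: (@ar_iff (fun g e =>
    (exists b, e 1 = pr b (e 0)) \/ (~ (exists a b, e 1 = pr a b) /\ e 0 = 0))).
  move=> g e; split.
    case=> [[b ->]|[h ->]]; first by rewrite rpK.
    by rewrite /rp; case: xgetP => // x _ [b hb]; case: h; exists b, x.
  have [[a [b ->]]|h] := EM (exists a b, e 1 = pr a b).
    by rewrite rpK => <-; left; exists a.
  move=> <-; right; split=> //.
  by rewrite /rp; case: xgetP => // x _ [b hb]; case: h; exists b, x.
by rewrite /pr; ar_auto.
Qed.

(* Goedel's beta function, which codes finite sequences arithmetically. *)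
Definition beta (a b i : nat) : nat := a %% (i.+1 * b).+1.

Lemma fn_beta t u v : Fn t -> Fn u -> Fn v ->
  Fn (fun g e => beta (t g e) (u g e) (v g e)).
Proof.
apply: fn3; apply: (@ar_iff (fun g e => exists q,
  e 1 = q * ((e 3).+1 * e 2).+1 + e 0 /\ e 0 < ((e 3).+1 * e 2).+1)).
  move=> g e; rewrite /beta; split.
    by case=> q [-> h]; rewrite modnMDl modn_small.
  by move=> <-; eexists; split; [apply: divn_eq|rewrite ltn_mod].
by ar_auto.
Qed.

(** A common prime factor divides the difference $(j-i)\,m!$, hence $m!$ because $j-i\le m$, and so
    it divides 1. *)
Lemma coprime_beta m i j : i < j -> j <= m ->
  coprime (i.+1 * m`!).+1 (j.+1 * m`!).+1.
Proof.
move=> ij jm; rewrite /coprime -[_ == _]negbK -dvdn1; apply/negP => h.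
set d := gcdn _ _ in h.
have d1 : 1 < d.
  have : 0 < d by rewrite gcdn_gt0.
  by case: d h => [|[|d]].
have [p pp pd] : exists2 p, prime p & p %| d by exists (pdiv d); rewrite ?pdiv_prime ?pdiv_dvd.
have p1 : p %| (i.+1 * m`!).+1 := dvdn_trans pd (dvdn_gcdl _ _).
have p2 : p %| (j.+1 * m`!).+1 := dvdn_trans pd (dvdn_gcdr _ _).
have : p %| (j - i) * m`!.
  have -> : (j - i) * m`! = (j.+1 * m`!).+1 - (i.+1 * m`!).+1 by nia.
  exact: dvdn_sub.
have pm : p %| m`! -> False.
  move=> pm; move: p1; rewrite -addn1 dvdn_addr ?dvdn_mull// dvdn1 => /eqP p1.
  by rewrite p1 in pp.
rewrite Euclid_dvdM// => /orP[pji|//].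
apply: pm; apply: dvdn_trans pji _; apply: dvdn_fact; lia.
Qed.

Lemma beta_seq (f : nat -> nat) m :
  exists a b, forall i, i < m -> beta a b i = f i.
Proof.
(* Large enough for the moduli [M i] to be pairwise coprime and to exceed the values [f i]; the
   Chinese remainder theorem is then applied one modulus at a time. *)
pose K := m + \sum_(i < m) f i.
pose M i := (i.+1 * K`!).+1.
have fK i : i < m -> f i < M i.
  move=> im; rewrite /M ltnS; apply: leq_trans (_ : K <= _).
    by rewrite /K (bigD1 (Ordinal im))//=; lia.
  have : K <= K`! by exact: fact_geq.
  by nia.
suff H k : k <= m -> exists a, forall i, i < k -> a = f i %[mod M i].
  have [a ha] := H m (leqnn _); exists a, K`! => i im.
  by rewrite /beta -/(M i) ha// modn_small ?fK.
elim: k => [|k IH] km; first by exists 0.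
have [a ha] := IH (ltnW km).
have cop : coprime (\prod_(i < k) M i) (M k).
  elim/big_ind: _ => [|x y hx hy|i _]; first exact: coprime1n.
    by rewrite coprimeMl hx.
  by apply: coprime_beta => //; rewrite /K; lia.
exists (chinese (\prod_(i < k) M i) (M k) a (f k)) => i.
rewrite ltnS leq_eqVlt => /orP[/eqP ->|ik]; first exact: chinese_modr.
rewrite -ha//.
have d : M i %| \prod_(i < k) M i by rewrite (bigD1 (Ordinal ik))//= dvdn_mulr.
have := chinese_modl cop a (f k) => /(congr1 (modn^~ (M i))).
by rewrite !modn_dvdm.
Qed.

Ltac fn_atom ::=
  match goal with
  | |- Fn (fun g e => pr _ _) => apply: fn_pr
  | |- Fn (fun g e => lp _) => apply: fn_lp
  | |- Fn (fun g e => rp _) => apply: fn_rp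
  | |- Fn (fun g e => beta _ _ _) => apply: fn_beta
  end.

(** * Joins of functions and closure properties of $\Pi^1_1$ predicates *)

Definition join (a b : nat -> nat) : nat -> nat :=
  fun i => if odd i then b i./2 else a i./2.
Definition fst2 (g : nat -> nat) : nat -> nat := fun i => g (i + i).
Definition snd2 (g : nat -> nat) : nat -> nat := fun i => g (i + i).+1.

Lemma fst2_join a b : fst2 (join a b) = a.
Proof. by apply/funext => i; rewrite /fst2 /join addnn odd_double half_double. Qed.

Lemma snd2_join a b : snd2 (join a b) = b.
Proof.
by apply/funext => i; rewrite /snd2 /join addnn /= odd_double /= uphalf_double.
Qed.

Lemma join_eta g : join (fst2 g) (snd2 g) = g.
Proof.
apply/funext => i; rewrite /join /fst2 /snd2 !addnn -[in RHS](odd_double_half i).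
by case: odd.
Qed.

Lemma ff_id : Ff (fun g e => g).
Proof. by apply: ar_eq; [apply: fn_fun; apply: fn_var|apply: fn_var]. Qed.

Lemma ff_fst F : Ff F -> Ff (fun g e => fst2 (F g e)).
Proof.
move=> hF; apply: (@ar_eq (fun g e => F g (fun i => e i.+2) (e 1 + e 1))); last exact: fn_var.
apply: (@fn_app (fun g e => F g (fun i => e i.+2))); first exact: (ff_shift (ff_shift hF)).
by ar_auto.
Qed.

Lemma ff_snd F : Ff F -> Ff (fun g e => snd2 (F g e)).
Proof.
move=> hF; apply: (@ar_eq (fun g e => F g (fun i => e i.+2) (e 1 + e 1).+1)); last exact: fn_var.
apply: (@fn_app (fun g e => F g (fun i => e i.+2))); first exact: (ff_shift (ff_shift hF)).
by ar_auto.
Qed.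

Lemma ff_join F G : Ff F -> Ff G -> Ff (fun g e => join (F g e) (G g e)).
Proof.
move=> hF hG.
apply: (@ar_iff (fun g e =>
  (exists j, e 1 = j + j /\ F g (fun i => e i.+2) j = e 0) \/
  (exists j, e 1 = (j + j).+1 /\ G g (fun i => e i.+2) j = e 0))).
  move=> g e; rewrite /join; have := odd_double_half (e 1); rewrite -addnn.
  case: (odd (e 1)) => /= <-; rewrite ?add0n ?add1n; set k := _./2.
    have -> : (k + k).+1./2 = k by rewrite addnn /= uphalf_double.
    split=> [[[j [h _]]|[j [h <-]]]|h]; [lia|congr (G g _ _); lia|].
    by right; exists k.
  have -> : (k + k)./2 = k by rewrite addnn half_double.
  split=> [[[j [h <-]]|[j [h _]]]|h]; [congr (F g _ _); lia|lia|].
  by left; exists k.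
apply: ar_or; apply: ar_ex; apply: ar_and; try (by ar_auto).
- exact: (ar_ren (fun i => if i is j.+2 then i.+1 else 1 - i) hF).
- exact: (ar_ren (fun i => if i is j.+2 then i.+1 else 1 - i) hG).
Qed.

Lemma ff_row F t : Ff F -> Fn t -> Ff (fun g e => fun i => F g e (pr (t g e) i)).
Proof.
move=> hF ht; apply: ar_eq; last exact: fn_var.
apply: (@fn_app (fun g e => F g (fun i => e i.+2))); first exact: (ff_shift (ff_shift hF)).
by apply: fn_pr; [apply: (fn_shift (fn_shift ht))|apply: fn_var].
Qed.

(* The parameter [g] and the quantified function are the two halves of the one
   function that a formula can speak about. *)
Definition Pi (P : ctxp) :=
  exists2 Q, Ar Q & forall g e, P g e <-> forall f, Q (join g f) e.
Definition Sg (P : ctxp) := Pi (fun g e => ~ P g e).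

Lemma pi_iff P Q : (forall g e, P g e <-> Q g e) -> Pi P -> Pi Q.
Proof. by move=> PQ [p ap pP]; exists p => // g e; rewrite -PQ. Qed.

Lemma pi_of_ar P : Ar P -> Pi P.
Proof.
move=> hP; exists (fun g e => P (fst2 g) e).
  by apply: ar_subst hP fn_var _; apply: ff_fst ff_id.
by move=> g e; split=> [h f|/(_ g)]; rewrite fst2_join.
Qed.

Lemma sg_of_ar P : Ar P -> Sg P.
Proof. by move=> hP; apply: pi_of_ar; apply: ar_not. Qed.

Lemma pi_and P Q : Pi P -> Pi Q -> Pi (fun g e => P g e /\ Q g e).
Proof.
move=> [p hp pP] [q hq qQ]; exists (fun g e => p g e /\ q g e); first exact: ar_and.
move=> g e; rewrite pP qQ; split=> [[h1 h2] f|h]; first by split.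
by split=> f; have [] := h f.
Qed.

(** Each disjunct reads its own half of [f]. With a shared function the disjunction under the
    quantifier would be weaker than the disjunction of the two universal statements. *)
Lemma pi_or P Q : Pi P -> Pi Q -> Pi (fun g e => P g e \/ Q g e).
Proof.
move=> [p hp pP] [q hq qQ].
exists (fun g e => p (join (fst2 g) (fst2 (snd2 g))) e \/
                   q (join (fst2 g) (snd2 (snd2 g))) e).
  have := (ff_fst ff_id, ff_snd ff_id) => -[h1 h2].
  by apply: ar_or; apply: ar_subst fn_var _ => //; apply: ff_join => //;
    [apply: ff_fst|apply: ff_snd].
move=> g e; rewrite pP qQ; split=> [h f|h].
  rewrite fst2_join snd2_join.
  by case: h => h; [left|right].
apply: contrapT => /not_orP[/existsNP[f1 h1] /existsNP[f2 h2]].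
have := h (join f1 f2); rewrite fst2_join snd2_join fst2_join snd2_join.
by case.
Qed.

Lemma pi_all (P : (nat -> nat) -> (nat -> nat) -> nat -> Prop) :
  Pi (fun g e => P g (fun i => e i.+1) (e 0)) -> Pi (fun g e => forall n, P g e n).
Proof.
move=> [q hq qP]; exists (fun g e => forall n, q g (scons n e)).
  apply: ar_all; apply: (@ar_subst q _ _ hq _ ff_id) => -[|i]; exact: fn_var.
move=> g e; split=> [h f n|h n].
  by apply/(qP g (scons n e)): f; apply: h.
by apply/(qP g (scons n e)) => f; apply: h.
Qed.

(** If every [n] has a counterexample function, countable choice gathers these as the rows of a
    single function; so the number quantifier moves inside the function quantifier. *)
Lemma pi_ex (P : (nat -> nat) -> (nat -> nat) -> nat -> Prop) :
  Pi (fun g e => P g (fun i => e i.+1) (e 0)) -> Pi (fun g e => exists n, P g e n).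
Proof.
move=> [q hq qP].
exists (fun g e => exists n, q (join (fst2 g) (fun i => snd2 g (pr n i))) (scons n e)).
  apply: ar_ex; apply: (@ar_subst q _ _ hq _ _) => [[|i]|]; try exact: fn_var.
  apply: ff_join; first exact: ff_fst ff_id.
  apply: (@ff_row (fun g e => snd2 g)) (fn_var 0); exact: ff_snd ff_id.
move=> g e; split=> [[n h] f|h].
  exists n; rewrite fst2_join snd2_join.
  by move/(qP g (scons n e)): h; apply.
apply: contrapT => /forallNP h'.
have {}h' n : exists f, ~ q (join g f) (scons n e).
  by apply/existsNP => h''; apply: (h' n); apply/(qP g (scons n e)).
have [F hF] := choice h'.
have [n] := h (fun c => F (lp c) (rp c)).
rewrite fst2_join snd2_join; under eq_fun do rewrite lpK rpK.
exact: hF.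
Qed.

Lemma pi_fun (P : (nat -> nat) -> (nat -> nat) -> (nat -> nat) -> Prop) :
  Pi (fun g e => P (fst2 g) e (snd2 g)) -> Pi (fun g e => forall f, P g e f).
Proof.
move=> [q hq qP].
exists (fun g e => q (join (join (fst2 g) (fst2 (snd2 g))) (snd2 (snd2 g))) e).
  apply: ar_subst hq fn_var _.
  have := (ff_fst ff_id, ff_snd ff_id) => -[h1 h2].
  by apply: ff_join; [apply: ff_join => //; apply: ff_fst|apply: ff_snd].
move=> g e; split=> [h w|h f].
  rewrite fst2_join snd2_join; set G := join g (fst2 w).
  have := qP G e; rewrite {1 2}/G fst2_join snd2_join => -[k _]; exact: k (h _) _.
have := qP (join g f) e; rewrite fst2_join snd2_join => -> k.
by have := h (join f k); rewrite !(fst2_join, snd2_join).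
Qed.

Lemma pi_env P E : Pi P -> (forall i, Fn (fun g e => E g e i)) ->
  Pi (fun g e => P g (E g e)).
Proof.
move=> [q hq qP] hE; exists (fun g e => q g (E (fst2 g) e)).
  apply: ar_subst hq _ ff_id => i.
  by apply: (ar_subst (hE i)) fn_var _; apply: ff_fst ff_id.
by move=> g e; rewrite qP; split=> h f; move: (h f); rewrite fst2_join.
Qed.

Lemma sg_and P Q : Sg P -> Sg Q -> Sg (fun g e => P g e /\ Q g e).
Proof. by move=> hP hQ; apply: pi_iff (pi_or hP hQ) => g e; rewrite not_andE. Qed.

Lemma sg_or P Q : Sg P -> Sg Q -> Sg (fun g e => P g e \/ Q g e).
Proof. by move=> hP hQ; apply: pi_iff (pi_and hP hQ) => g e; rewrite not_orE. Qed.

Lemma sg_not P : Pi P -> Sg (fun g e => ~ P g e).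
Proof. by apply: pi_iff => g e; rewrite notE. Qed.

Lemma pi_imp P Q : Sg P -> Pi Q -> Pi (fun g e => P g e -> Q g e).
Proof. by move=> hP hQ; apply: pi_iff (pi_or hP hQ) => g e; rewrite implyE. Qed.

Lemma sg_imp P Q : Pi P -> Sg Q -> Sg (fun g e => P g e -> Q g e).
Proof. by move=> hP hQ; apply: pi_iff (pi_and hP hQ) => g e; rewrite not_implyE. Qed.

Lemma sg_all (P : (nat -> nat) -> (nat -> nat) -> nat -> Prop) :
  Sg (fun g e => P g (fun i => e i.+1) (e 0)) -> Sg (fun g e => forall n, P g e n).
Proof.
move=> hP; apply: pi_iff (pi_ex (P := fun g e n => ~ P g e n) hP) => g e.
by rewrite existsNE.
Qed.

Lemma sg_ex (P : (nat -> nat) -> (nat -> nat) -> nat -> Prop) :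
  Sg (fun g e => P g (fun i => e i.+1) (e 0)) -> Sg (fun g e => exists n, P g e n).
Proof.
move=> hP; apply: pi_iff (pi_all (P := fun g e n => ~ P g e n) hP) => g e.
by rewrite forallNE.
Qed.

Lemma sg_fun (P : (nat -> nat) -> (nat -> nat) -> (nat -> nat) -> Prop) :
  Sg (fun g e => P (fst2 g) e (snd2 g)) -> Sg (fun g e => exists f, P g e f).
Proof.
move=> hP; apply: pi_iff (pi_fun (P := fun g e f => ~ P g e f) hP) => g e.
by rewrite forallNE.
Qed.

Lemma pi1 (R : nat -> Prop) t : Pi (fun g e => R (e 0)) -> Fn t ->
  Pi (fun g e => R (t g e)).
Proof.
move=> hR ht.
by apply: (pi_env (E := fun g e => scons (t g e) (fun=> 0)) hR) => -[|i] //=; exact: fn_const.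
Qed.

Lemma pi2 (R : nat -> nat -> Prop) t u : Pi (fun g e => R (e 0) (e 1)) ->
  Fn t -> Fn u -> Pi (fun g e => R (t g e) (u g e)).
Proof.
move=> hR ht hu.
by apply: (pi_env (E := fun g e => scons (t g e) (scons (u g e) (fun=> 0))) hR)
  => -[|[|i]] //=; exact: fn_const.
Qed.

Lemma sg2 (R : nat -> nat -> Prop) t u : Sg (fun g e => R (e 0) (e 1)) ->
  Fn t -> Fn u -> Sg (fun g e => R (t g e) (u g e)).
Proof. exact: (@pi2 (fun a b => ~ R a b)). Qed.

Lemma pi_not P : Sg P -> Pi (fun g e => ~ P g e).
Proof. by []. Qed.

Ltac pi_step := cbn beta;
  match goal with
  | |- Sg (fun g e => _ /\ _) => apply: sg_and
  | |- Sg (fun g e => _ \/ _) => apply: sg_or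
  | |- Sg (fun g e => ~ _) => apply: sg_not
  | |- Sg (fun g e => exists n : nat, _) => apply: sg_ex
  | |- Sg (fun g e => exists n : nat -> nat, _) => apply: sg_fun
  | |- Sg (fun g e => forall n : nat, _) => apply: sg_all
  | |- Sg (fun g e => _ -> _) => apply: sg_imp
  | |- Pi (fun g e => _ /\ _) => apply: pi_and
  | |- Pi (fun g e => _ \/ _) => apply: pi_or
  | |- Pi (fun g e => ~ _) => apply: pi_not
  | |- Pi (fun g e => exists n : nat, _) => apply: pi_ex
  | |- Pi (fun g e => forall n : nat, _) => apply: pi_all
  | |- Pi (fun g e => forall n : nat -> nat, _) => apply: pi_fun
  | |- Pi (fun g e => _ -> _) => apply: pi_imp
  | h : _ |- Sg _ => simple apply h
  | h : _ |- Pi _ => simple apply h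
  | |- Sg _ => apply: sg_of_ar; ar_step
  | |- Pi _ => apply: pi_of_ar; ar_step
  | _ => ar_step
  end.
Ltac pi_auto := rewrite /fst2 /snd2; repeat (pi_step; rewrite /fst2 /snd2).

(** * Skolem normal form *)

(* Quantifier-free formulas with one symbol per Skolem function: in the language of
   [fm] they could not be told apart, nor renamed, under [TFun]. *)
Inductive ktm : Type :=
| KVar of nat
| KZero
| KSucc of ktm
| KAdd of ktm & ktm
| KMul of ktm & ktm
| KFun of nat & ktm.

Inductive kfm : Type :=
| KEq of ktm & ktm
| KNot of kfm
| KAnd of kfm & kfm
| KOr of kfm & kfm.

Notation fam := (nat -> nat -> nat).

Fixpoint kteval (H : fam) (e : nat -> nat) (t : ktm) : nat :=
  match t with
  | KVar i => e i
  | KZero => 0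
  | KSucc t1 => (kteval H e t1).+1
  | KAdd t1 t2 => kteval H e t1 + kteval H e t2
  | KMul t1 t2 => kteval H e t1 * kteval H e t2
  | KFun j t1 => H j (kteval H e t1)
  end.

Fixpoint ksat (H : fam) (e : nat -> nat) (p : kfm) : Prop :=
  match p with
  | KEq t1 t2 => kteval H e t1 = kteval H e t2
  | KNot p1 => ~ ksat H e p1
  | KAnd p1 p2 => ksat H e p1 /\ ksat H e p2
  | KOr p1 p2 => ksat H e p1 \/ ksat H e p2
  end.

Definition KT (t : fam -> (nat -> nat) -> nat) := exists T, forall H e, t H e = kteval H e T.
Definition KQ (K : fam -> (nat -> nat) -> Prop) :=
  exists k, forall H e, K H e <-> ksat H e k.

Lemma kt_var i : KT (fun H e => e i).
Proof. by exists (KVar i). Qed.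

Lemma kt_const n : KT (fun H e => n).
Proof.
elim: n => [|n [T hT]]; first by exists KZero.
by exists (KSucc T) => g e /=; rewrite -(hT g e).
Qed.

Lemma kt_fun j t : KT t -> KT (fun H e => H j (t H e)).
Proof. by move=> [T hT]; exists (KFun j T) => H e /=; rewrite hT. Qed.

Lemma kt_pr t u : KT t -> KT u -> KT (fun H e => pr (t H e) (u H e)).
Proof.
move=> [T hT] [U hU]; exists (KAdd (KMul (KAdd T U) (KAdd T U)) T) => H e /=.
by rewrite hT hU.
Qed.

Lemma kt_tevalf t : KT (fun H e => tevalf (H 0) e t).
Proof.
elim: t => [i||s [S hS]|s [S hS] s' [S' hS']|s [S hS] s' [S' hS']|s [S hS]].
- exact: kt_var.
- by exists KZero.
- by exists (KSucc S) => g e /=; rewrite hS.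
- by exists (KAdd S S') => g e /=; rewrite hS hS'.
- by exists (KMul S S') => g e /=; rewrite hS hS'.
- by exists (KFun 0 S) => g e /=; rewrite hS.
Qed.

Lemma kq_eq t u : KT t -> KT u -> KQ (fun H e => t H e = u H e).
Proof. by move=> [T hT] [U hU]; exists (KEq T U) => H e; rewrite hT hU. Qed.

Lemma kq_not P : KQ P -> KQ (fun H e => ~ P H e).
Proof. by move=> [p hp]; exists (KNot p) => H e; rewrite hp. Qed.

Lemma kq_and P Q : KQ P -> KQ Q -> KQ (fun H e => P H e /\ Q H e).
Proof. by move=> [p hp] [q hq]; exists (KAnd p q) => H e; rewrite hp hq. Qed.

Lemma kq_or P Q : KQ P -> KQ Q -> KQ (fun H e => P H e \/ Q H e).
Proof. by move=> [p hp] [q hq]; exists (KOr p q) => H e; rewrite hp hq. Qed.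

Lemma kq_subst K F E : KQ K -> (forall i, KT (fun H e => E H e i)) ->
  (forall j t, KT t -> KT (fun H e => F H e j (t H e))) ->
  KQ (fun H e => K (F H e) (E H e)).
Proof.
move=> [k hk] hE hF.
have ht T : KT (fun H e => kteval (F H e) (E H e) T).
  elim: T => [i||s [S hS]|s [S hS] s' [S' hS']|s [S hS] s' [S' hS']|j s hs].
  - exact: hE.
  - by exists KZero.
  - by exists (KSucc S) => g e /=; rewrite hS.
  - by exists (KAdd S S') => g e /=; rewrite hS hS'.
  - by exists (KMul S S') => g e /=; rewrite hS hS'.
  - exact: hF.
suff [q hq] : KQ (fun H e => ksat (F H e) (E H e) k).
  by exists q => H e; rewrite -hq hk.
elim: k {K hk} => [t u|p IH|p IHp q IHq|p IHp q IHq] /=.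
- exact: kq_eq.
- exact: kq_not.
- exact: kq_and.
- exact: kq_or.
Qed.

(* A block of [d] universal quantifiers is an environment [e'] with tail [e]. *)
Definition Skolem_nf (P : ctxp) := exists d : nat, exists2 K, KQ K & forall g e, P g e <->
  exists2 H : fam, H 0 = g & forall e', (forall i, e' (d + i) = e i) -> K H e'.

Lemma nf_iff P Q : (forall g e, P g e <-> Q g e) -> Skolem_nf P -> Skolem_nf Q.
Proof. by move=> PQ [d [K hK h]]; exists d, K => // g e; rewrite -PQ. Qed.

Lemma nf_base K : KQ (fun H e => K (H 0) e) -> Skolem_nf K.
Proof.
move=> hK; exists 0, (fun H e => K (H 0) e) => // g e; split.
  by move=> h; exists (fun _ => g) => // e' he; have -> : e' = e by apply/funext.
by move=> [H <-]; apply.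
Qed.

(** Two blocks of universal variables are stacked over a common context: [kblock1] keeps the first
    [d1] variables and the context, [kblock2] drops the first [d1]. *)
Definition kblock1 (d1 d2 : nat) (e : nat -> nat) : nat -> nat :=
  fun i => if i < d1 then e i else e (i + d2).
Definition kblock2 (d1 : nat) (e : nat -> nat) : nat -> nat :=
  fun i => e (i + d1).

Lemma kblock1P d1 d2 e (Q : (nat -> nat) -> Prop) :
  (forall e', (forall i, e' (d1 + d2 + i) = e i) -> Q (kblock1 d1 d2 e')) <->
  (forall e', (forall i, e' (d1 + i) = e i) -> Q e').
Proof.
split=> h e' he'; last first.
  apply: h => i; rewrite /kblock1; have -> : (d1 + i < d1) = false by lia.
  rewrite -he'.
  by congr e'; lia.
pose e1 i := if i < d1 then e' i else e (i - (d1 + d2)).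
have -> : e' = kblock1 d1 d2 e1.
  apply/funext => i; rewrite /kblock1 /e1; case: ltnP => // h1.
  have -> : (i + d2 < d1) = false by lia.
  by rewrite -he'; congr e'; lia.
apply: h => i; rewrite /e1; have -> : (d1 + d2 + i < d1) = false by lia.
by congr e; lia.
Qed.

Lemma kblock2P d1 d2 e (Q : (nat -> nat) -> Prop) :
  (forall e', (forall i, e' (d1 + d2 + i) = e i) -> Q (kblock2 d1 e')) <->
  (forall e', (forall i, e' (d2 + i) = e i) -> Q e').
Proof.
split=> h e' he'; last first.
  by apply: h => i; rewrite /kblock2 -he'; congr e'; lia.
pose e1 i := if i < d1 then 0 else e' (i - d1).
have -> : e' = kblock2 d1 e1.
  apply/funext => i; rewrite /kblock2 /e1.
  have -> : (i + d1 < d1) = false by lia.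
  by congr e'; lia.
apply: h => i; rewrite /e1; have -> : (d1 + d2 + i < d1) = false by lia.
by rewrite -he'; congr e'; lia.
Qed.

(** Renaming of the Skolem symbols. Symbol 0 is the given function of the formula and stays
    fixed. *)
Definition kshift (r : nat -> nat) (H : fam) : fam :=
  fun j => H (if j is j'.+1 then (r j').+1 else 0).

Lemma kt_block1 d1 d2 i : KT (fun H e => kblock1 d1 d2 e i).
Proof. by rewrite /kblock1; case: (i < d1); apply: kt_var. Qed.

Lemma kt_block2 d1 i : KT (fun H e => kblock2 d1 e i).
Proof. exact: kt_var. Qed.

Lemma kt_shift r j t : KT t -> KT (fun H e => kshift r H j (t H e)).
Proof. exact: kt_fun. Qed.

Lemma nf_and P Q : Skolem_nf P -> Skolem_nf Q -> Skolem_nf (fun g e => P g e /\ Q g e).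
Proof.
move=> [d1 [K1 hK1 h1]] [d2 [K2 hK2 h2]].
exists (d1 + d2), (fun H e => K1 (kshift double H) (kblock1 d1 d2 e) /\
  K2 (kshift (fun j => j.*2.+1) H) (kblock2 d1 e)).
  by apply: kq_and; apply: kq_subst => // *; [exact: kt_block1|exact: kt_shift
    |exact: kt_block2|exact: kt_shift].
move=> g e; rewrite h1 h2; split.
  move=> [[H1 H10 k1] [H2 H20 k2]].
  exists (fun j => if j is j'.+1 then (if odd j' then H2 else H1) j'./2.+1 else g) => //.
  move=> e' he'; split.
    have -> : kshift double (fun j => if j is j'.+1 then (if odd j' then H2 else H1) j'./2.+1 else g) = H1.
      apply/funext => -[|j] /=; rewrite /kshift//.
      by rewrite odd_double half_double.
    by move: e' he'; apply/(@kblock1P d1 d2 e (K1 H1)).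
  have -> : kshift (fun j => j.*2.+1)
      (fun j => if j is j'.+1 then (if odd j' then H2 else H1) j'./2.+1 else g) = H2.
    apply/funext => -[|j] /=; rewrite /kshift//=.
    by rewrite odd_double uphalf_double.
  by move: e' he'; apply/(@kblock2P d1 d2 e (K2 H2)).
move=> [H H0 k]; split.
  exists (kshift double H) => //; apply/(@kblock1P d1 d2) => e' he'.
  by have [] := k e' he'.
exists (kshift (fun j => j.*2.+1) H) => //; apply/(@kblock2P d1 d2) => e' he'.
by have [] := k e' he'.
Qed.

(** The disjunct has to be chosen before the universal block, so the choice is stored as the value
    at 0 of a fresh Skolem function. *)
Lemma nf_or P Q : Skolem_nf P -> Skolem_nf Q -> Skolem_nf (fun g e => P g e \/ Q g e).
Proof.
move=> [d1 [K1 hK1 h1]] [d2 [K2 hK2 h2]].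
exists (d1 + d2), (fun H e => (H 1 0 = 0 /\ K1 (kshift succn H) (kblock1 d1 d2 e)) \/
  (H 1 0 = 1 /\ K2 (kshift succn H) (kblock2 d1 e))).
  apply: kq_or; apply: kq_and.
  - by apply: kq_eq; [apply: kt_fun|]; apply: kt_const.
  - by apply: kq_subst => // *; [exact: kt_block1|exact: kt_shift].
  - by apply: kq_eq; [apply: kt_fun|]; apply: kt_const.
  - by apply: kq_subst => // *; [exact: kt_block2|exact: kt_shift].
move=> g e; rewrite h1 h2; split.
  case=> -[H H0 k].
    exists (fun j => if j is j'.+1 then if j' is j''.+1 then H j''.+1 else fun _ => 0 else g) => //.
    move=> e' he'; left; split=> //.
    set F := kshift _ _; have -> : F = H by apply/funext => -[|[|j]].
    by move: e' he'; apply/(@kblock1P d1 d2 e (K1 H)).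
  exists (fun j => if j is j'.+1 then if j' is j''.+1 then H j''.+1 else fun _ => 1 else g) => //.
  move=> e' he'; right; split=> //.
  set F := kshift _ _; have -> : F = H by apply/funext => -[|[|j]].
  by move: e' he'; apply/(@kblock2P d1 d2 e (K2 H)).
move=> [H H0 k]; have [z|z] := eqVneq (H 1 0) 0.
  left; exists (kshift succn H) => //; apply/(@kblock1P d1 d2) => e' he'.
  by have [[]//|[]] := k e' he'; rewrite z.
right; exists (kshift succn H) => //; apply/(@kblock2P d1 d2) => e' he'.
by have [[z']|[]//] := k e' he'; rewrite z' in z.
Qed.

Lemma nf_ex P : Skolem_nf P -> Skolem_nf (fun g e => exists n, P g (scons n e)).
Proof.
move=> [d [K hK hP]].
pose E (H : fam) (e : nat -> nat) i :=
  if i < d then e i else if i == d then H 1 0 else e i.-1.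
exists d, (fun H e => K (kshift succn H) (E H e)).
  apply: kq_subst => // [i|j t]; last exact: kt_shift.
  rewrite /E; case: (i < d); first exact: kt_var.
  by case: (i == d); [apply: kt_fun; exact: kt_const|exact: kt_var].
move=> g e; split.
  move=> [n /hP[H H0 k]].
  exists (fun j => if j is j'.+1 then if j' is j''.+1 then H j''.+1 else fun _ => n else g) => //.
  move=> e' he'.
  set F := kshift _ _; have -> : F = H by apply/funext => -[|[|j]].
  apply: k => -[|i]; rewrite /E.
    by rewrite addn0 ltnn eqxx.
  have -> : (d + i.+1 < d) = false by lia.
  have -> : (d + i.+1 == d) = false by lia.
  by rewrite addnS /= he'.
move=> [H H0 k]; exists (H 1 0); apply/hP; exists (kshift succn H) => // e' he'.
pose e1 i := if i < d then e' i else e (i - d).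
have -> : e' = E H e1.
  apply/funext => i; rewrite /E /e1.
  case: ltnP => // di; case: eqP => [->|id].
    by have := he' 0; rewrite addn0.
  have -> : (i.-1 < d) = false by lia.
  have -> : i.-1 - d = (i - d).-1 by lia.
  by have := he' (i - d).-1.+1 => /= <-; congr e'; lia.
apply: k => i; rewrite /e1; have -> : (d + i < d) = false by lia.
by congr e; lia.
Qed.

(** The new variable sits at index [d], just after the inner block, and becomes an additional
    argument of every Skolem function, paired in by [pr]. Choice merges the families obtained for
    the separate [n]. *)
Lemma nf_all P : Skolem_nf P -> Skolem_nf (fun g e => forall n, P g (scons n e)).
Proof.
move=> [d [K hK hP]].
pose F (H : fam) (e : nat -> nat) : fam := fun j =>
  if j is j'.+1 then fun i => H j (pr (e d) i) else H 0.
exists d.+1, (fun H e => K (F H e) e).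
  apply: kq_subst => // [i|[|j] t ht]; first exact: kt_var.
    exact: kt_fun.
  by apply: kt_fun; apply: kt_pr => //; exact: kt_var.
move=> g e; split.
  move=> h; have {}h n : exists H : fam, H 0 = g /\
      forall e', (forall i, e' (d + i) = scons n e i) -> K H e'.
    by have /hP[H] := h n; exists H.
  have [HH hH] := choice h.
  exists (fun j => if j is j'.+1 then fun c => HH (lp c) j (rp c) else g) => // e' he'.
  set H := F _ _; have -> : H = HH (e' d).
    apply/funext => -[|j]; rewrite /H /F; first by have [] := hH (e' d).
    by apply/funext => i; rewrite lpK rpK.
  have [_] := hH (e' d); apply => -[|i]; first by rewrite addn0.
  by rewrite addnS -addSn he'.
move=> [H H0 k] n; apply/hP.
exists (fun j => if j is j'.+1 then fun i => H j (pr n i) else g) => // e' he'.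
have dn : e' d = n by have := he' 0; rewrite addn0.
have := k e'; rewrite /F dn H0; apply => i.
by have := he' i.+1; rewrite addnS.
Qed.

(** The formula and its negation are treated together, because [FNot] exchanges them; no prenex form
    is needed. *)
Lemma nf_satf p : Skolem_nf (fun g e => satf g e p) /\ Skolem_nf (fun g e => ~ satf g e p).
Proof.
elim: p => [t u|p [IHp IHn]|p [IHp IHpn] q [IHq IHqn]|p [IHp IHpn] q [IHq IHqn]|p [IHp IHn]|p [IHp IHn]] /=.
- have hK : KQ (fun H e => tevalf (H 0) e t = tevalf (H 0) e u).
    exact (kq_eq (kt_tevalf t) (kt_tevalf u)).
  by split; apply: nf_base => //; apply: (kq_not hK).
- by split=> //; apply: nf_iff IHp => g e; rewrite notE.
- split; first exact: nf_and.
  by apply: nf_iff (nf_or IHpn IHqn) => g e; rewrite not_andE.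
- split; first exact: nf_or.
  by apply: nf_iff (nf_and IHpn IHqn) => g e; rewrite not_orE.
- split; first exact (nf_all IHp).
  by apply: nf_iff (nf_ex IHn) => g e; rewrite existsNE.
- split; first exact (nf_ex IHp).
  by apply: nf_iff (nf_all IHn) => g e; rewrite forallNE.
Qed.

(** * A norm on Pi^1_1 sets *)

Definition rows (w : nat -> nat) : fam := fun j i => w (pr j i).

Fixpoint ktbound (N : nat) (w e : nat -> nat) (t : ktm) : Prop :=
  match t with
  | KVar i => True
  | KZero => True
  | KSucc t1 => ktbound N w e t1
  | KAdd t1 t2 => ktbound N w e t1 /\ ktbound N w e t2
  | KMul t1 t2 => ktbound N w e t1 /\ ktbound N w e t2
  | KFun j t1 => ktbound N w e t1 /\ pr j (kteval (rows w) e t1) < N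
  end.

(* The evaluation of [p] queries [w] only below [N]. *)
Fixpoint kbound (N : nat) (w e : nat -> nat) (p : kfm) : Prop :=
  match p with
  | KEq t1 t2 => ktbound N w e t1 /\ ktbound N w e t2
  | KNot p1 => kbound N w e p1
  | KAnd p1 p2 => kbound N w e p1 /\ kbound N w e p2
  | KOr p1 p2 => kbound N w e p1 /\ kbound N w e p2
  end.

Lemma ktbound_le N M w e t : N <= M -> ktbound N w e t -> ktbound M w e t.
Proof.
move=> NM; elim: t => //= [t IHt u IHu [/IHt ? /IHu]|t IHt u IHu [/IHt ? /IHu]|j t IH [/IH ?]] //.
by move=> h; split=> //; lia.
Qed.

Lemma kbound_le N M w e p : N <= M -> kbound N w e p -> kbound M w e p.
Proof.
by move=> NM; elim: p => //= [t u|p IHp q IHq|p IHp q IHq] [h1 h2]; split;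
  auto; apply: ktbound_le NM _.
Qed.

Lemma ktbound_ex w e t : exists N, ktbound N w e t.
Proof.
elim: t => [i||//|t [N hN] u [M hM]|t [N hN] u [M hM]|j t [N hN]] /=; try by exists 0.
- by exists (maxn N M); split; [apply: ktbound_le hN|apply: ktbound_le hM]; lia.
- by exists (maxn N M); split; [apply: ktbound_le hN|apply: ktbound_le hM]; lia.
- exists (maxn N (pr j (kteval (rows w) e t)).+1); split; last lia.
  by apply: ktbound_le hN; lia.
Qed.

Lemma kbound_ex w e p : exists N, kbound N w e p.
Proof.
elim: p => [t u|//|p [N hN] q [M hM]|p [N hN] q [M hM]] /=.
- have [N hN] := ktbound_ex w e t; have [M hM] := ktbound_ex w e u.
  by exists (maxn N M); split; [apply: ktbound_le hN|apply: ktbound_le hM]; lia.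
- by exists (maxn N M); split; [apply: kbound_le hN|apply: kbound_le hM]; lia.
- by exists (maxn N M); split; [apply: kbound_le hN|apply: kbound_le hM]; lia.
Qed.

Lemma kteval_local N w w' e t : (forall i, i < N -> w i = w' i) ->
  ktbound N w e t -> ktbound N w' e t /\ kteval (rows w) e t = kteval (rows w') e t.
Proof.
move=> ww'; elim: t => //=.
- by move=> t IH /IH[? ->].
- by move=> t IHt u IHu [/IHt[? ->] /IHu[? ->]].
- by move=> t IHt u IHu [/IHt[? ->] /IHu[? ->]].
- by move=> j t IH [/IH[? <-] h]; split=> //; exact: ww'.
Qed.

Lemma ksat_local N w w' e p : (forall i, i < N -> w i = w' i) ->
  kbound N w e p -> kbound N w' e p /\ (ksat (rows w) e p <-> ksat (rows w') e p).
Proof.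
move=> ww'; elim: p => //=.
- by move=> t u [/(kteval_local ww')[? ->] /(kteval_local ww')[? ->]].
- by move=> p IH /IH[? ->].
- by move=> p IHp q IHq [/IHp[? ->] /IHq[? ->]].
- by move=> p IHp q IHq [/IHp[? ->] /IHq[? ->]].
Qed.

Lemma fn_kteval F E t : (forall i, Fn (fun g e => E g e i)) -> Ff F ->
  Fn (fun g e => kteval (rows (F g e)) (E g e) t).
Proof.
move=> hE hF; elim: t => [i||s hs|s hs u hu|s hs u hu|j s hs] /=.
- exact: hE.
- exact: fn_const.
- exact: fn_S.
- exact: fn_add.
- exact: fn_mul.
- by apply: fn_app hF _; apply: fn_pr => //; apply: fn_const.
Qed.

Lemma ar_ksat F E p : (forall i, Fn (fun g e => E g e i)) -> Ff F ->
  Ar (fun g e => ksat (rows (F g e)) (E g e) p).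
Proof.
move=> hE hF; elim: p => [t u|p IH|p IHp q IHq|p IHp q IHq] /=.
- by apply: ar_eq; apply: fn_kteval.
- exact: ar_not.
- exact: ar_and.
- exact: ar_or.
Qed.

Lemma ar_ktbound N F E t : Fn N -> (forall i, Fn (fun g e => E g e i)) -> Ff F ->
  Ar (fun g e => ktbound (N g e) (F g e) (E g e) t).
Proof.
move=> hN hE hF; elim: t => [i||s hs|s hs u hu|s hs u hu|j s hs] //=; try exact: ar_const.
- exact: ar_and.
- exact: ar_and.
- apply: ar_and => //; apply: ar_le => //; apply: fn_S; apply: fn_pr; first exact: fn_const.
  exact: fn_kteval.
Qed.

Lemma ar_kbound N F E p : Fn N -> (forall i, Fn (fun g e => E g e i)) -> Ff F ->
  Ar (fun g e => kbound (N g e) (F g e) (E g e) p).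
Proof.
move=> hN hE hF; elim: p => [t u|p IH|p IHp q IHq|p IHp q IHq] //=.
- by apply: ar_and; apply: ar_ktbound.
- exact: ar_and.
- exact: ar_and.
Qed.

Fixpoint ballb (N d : nat) (e : nat -> nat) (Q : (nat -> nat) -> Prop) : Prop :=
  if d is d'.+1 then forall n, n < N -> ballb N d' (scons n e) Q else Q e.

Lemma ballbP N d e Q : ballb N d e Q <->
  forall e', (forall i, e' (d + i) = e i) -> (forall i, i < d -> e' i < N) -> Q e'.
Proof.
elim: d e => [|d IH] e /=.
  by split=> [h e' he' _|]; [have -> : e' = e by apply/funext|apply].
split=> [h e' he' b|h n nN].
  have /h/IH : e' d < N by apply: b.
  apply; last by move=> i di; apply: b; lia.
  by case=> [|i]; rewrite ?addn0// addnS -addSn he'.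
apply/IH => e' he' b; apply: h => [i|i].
  by rewrite addSn -addnS he'.
rewrite ltnS leq_eqVlt => /orP[/eqP ->|]; last exact: b.
by have := he' 0; rewrite addn0 /= => ->.
Qed.

(* The initial segment of [w] of length [N] does not yet refute the matrix [k]. *)
Definition alive (k : kfm) (d x : nat) (w : nat -> nat) (N : nat) :=
  ballb N d (scons x (fun=> 0)) (fun e => kbound N w e k -> ksat (rows w) e k).

(* A node is [pr N (pr a b)]: a length and a beta code of a sequence. *)
Definition nodef (c : nat) : nat -> nat := beta (lp (rp c)) (rp (rp c)).

(** The tree of finite attempts at a function whose rows satisfy the matrix for all values of the
    block. A sequence has many beta codes and so occurs as many nodes, which changes neither
    well-foundedness nor simulations. *)
Definition child (k : kfm) (d x c' c : nat) :=
  [/\ lp c' = (lp c).+1, forall i, i < lp c -> nodef c' i = nodef c i &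
      alive k d x (nodef c') (lp c')].

Definition root := pr 0 (pr 0 0).

Lemma ar_child k d t u v : Fn t -> Fn u -> Fn v ->
  Ar (fun g e => child k d (t g e) (u g e) (v g e)).
Proof.
apply: ar3.
apply: (@ar_iff (fun g e => lp (e 1) = (lp (e 2)).+1 /\
  ((forall i, i < lp (e 2) -> nodef (e 1) i = nodef (e 2) i) /\
   alive k d (e 0) (nodef (e 1)) (lp (e 1))))).
  by move=> g e; split=> [[? []]|[]].
apply: ar_and; first by ar_auto.
apply: ar_and; first by rewrite /nodef; ar_auto.
rewrite /alive.
have hF : Ff (fun g e => nodef (e 1)) by rewrite /Ff /nodef; ar_auto.
have hN : Fn (fun g e => lp (e 1)) by ar_auto.
have hE i : Fn (fun g e => scons (e 0) (fun=> 0) i).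
  by case: i => [|i] /=; ar_auto.
set N := fun (g e : nat -> nat) => lp (e 1) in hN *.
set F := fun (g e : nat -> nat) => nodef (e 1) in hF *.
set E := fun (g e : nat -> nat) => scons (e 0) (fun=> 0).
rewrite -/(E _ _) in hE.
suff H : forall d (N : ctxf) (F E : ctxF), Fn N -> (forall i, Fn (fun g e => E g e i)) -> Ff F ->
  Ar (fun g e => ballb (N g e) d (E g e)
    (fun e' => kbound (N g e) (F g e) e' k -> ksat (rows (F g e)) e' k)).
  exact: (H d N F E).
move=> {d N F E hN hF hE}; elim=> [|d IH] N F E hN hE hF /=.
  by apply: ar_imp; [apply: ar_kbound|apply: ar_ksat].
apply: ar_all; apply: ar_imp.
  by apply: ar_le; [ar_auto|exact: (fn_shift hN)].
apply: (IH (fun g e => N g (fun i => e i.+1)) (fun g e => F g (fun i => e i.+1))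
  (fun g e => scons (e 0) (E g (fun i => e i.+1)))).
- exact: fn_shift.
- by case=> [|i] /=; [ar_auto|exact: (fn_shift (hE i))].
- exact: ff_shift.
Qed.

(** The nodes of an infinite path glue to a function [w]; an instance of the matrix queries only
    finitely much of it, so it is already decided by some node that is alive. Conversely, the
    initial segments of a solution [w] are all alive and form an infinite path. *)
Lemma child_wf k d x :
  ~ (exists w, forall e', (forall i, e' (d + i) = scons x (fun=> 0) i) -> ksat (rows w) e' k) <->
  Acc (child k d x) root.
Proof.
split=> [h|hacc [w hw]].
  apply: contrapT => nacc; apply: h.
  pose Bad c := ~ Acc (child k d x) c.
  have step c : exists c', Bad c -> Bad c' /\ child k d x c' c.
    have [bc|] := EM (Bad c); last by exists 0.
    apply: contrapT => /forallNP h; apply: bc; constructor => c' cc'.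
    by apply: contrapT => bc'; apply: (h c').
  have [nx hnx] := choice step.
  pose u n := iter n nx root.
  have ub n : Bad (u n) by elim: n => //= n IH; have [] := hnx _ IH.
  have uc n : child k d x (u n.+1) (u n) by have [] := hnx _ (ub n).
  have ul n : lp (u n) = n.
    elim: n => [|n IH]; first by rewrite /u /root /= lpK.
    by have [-> _ _] := uc n; rewrite IH.
  pose w i := nodef (u i.+1) i.
  have uw n i : i < n -> nodef (u n) i = w i.
    elim: n => // n IH; rewrite ltnS leq_eqVlt => /orP[/eqP -> //|lin].
    by have [_ h _] := uc n; rewrite h ?ul// IH.
  exists w => e' he'.
  have [N hN] := kbound_ex w e' k.
  (* Beyond all queries made by this instance and beyond the values of its block variables, so that
     being alive at length [M] includes this instance. *)
  pose M := (N + \sum_(i < d) e' i).+1.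
  have /kbound_le hM : N <= M by rewrite /M; lia.
  have loc : forall i, i < M -> w i = nodef (u M) i by move=> i /uw.
  have [hb ->] := ksat_local loc (hM _ _ _ hN).
  have [_ _ /ballbP al] := uc (N + \sum_(i < d) e' i).
  rewrite ul -/M in al; apply: (al e') => // i id.
  by rewrite /M (bigD1 (Ordinal id))//=; lia.
suff H c : Acc (child k d x) c -> (forall i, i < lp c -> nodef c i = w i) -> False.
  by apply: H hacc _ => i; rewrite /root lpK.
elim=> {}c _ IH hc.
have [a [b hab]] := beta_seq w (lp c).+1.
pose c' := pr (lp c).+1 (pr a b).
have nc' i : i <= lp c -> nodef c' i = w i.
  by move=> h; rewrite /nodef /c' !(rpK, lpK) hab.
apply: (IH c'); last by move=> i; rewrite {1}/c' lpK => /nc'.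
split; first by rewrite /c' lpK.
  by move=> i hi; rewrite hc// nc'// ltnW.
rewrite {2}/c' lpK; apply/ballbP => e' he' _ hb.
have [_ ->] := @ksat_local (lp c).+1 _ w _ _ nc' hb.
exact: hw.
Qed.

(** The Skolem normal form of the negated matrix makes the failure of [A x] the existence of a
    solution [w], that is, of an infinite path. *)
Lemma pi_tree (A : nat -> Prop) : Pi (fun g e => A (e 0)) ->
  exists k d, forall x, A x <-> Acc (child k d x) root.
Proof.
move=> [q [p hp] hA]; have [_ [d [K [k hk] hK]]] := nf_satf p.
exists k, d => x; rewrite -child_wf.
have := hA (fun=> 0) (scons x (fun=> 0)) => /= ->.
pose e := scons x (fun=> 0).
have {}hK g : ~ satf g e p <-> exists2 H, H 0 = g & forall e', (forall i, e' (d + i) = e i) -> ksat H e' k.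
  rewrite (hK g e); split=> -[H H0 h]; exists H => // e' he'.
    by apply/hk; apply: h.
  by apply/hk; apply: h.
split=> [h [w hw]|h f].
  have: ~ satf (rows w 0) e p by apply/hK; exists (rows w).
  (* Row 0 of [w] is a join with an arbitrary parameter half; as [A] does not depend on the
     parameter, that half may serve as one. *)
  apply; apply/hp; have := hA (fst2 (rows w 0)) e => -[h' _].
  rewrite -(join_eta (rows w 0)); apply: h'.
  by apply/(hA (fun=> 0) e).
apply: contrapT => nq.
have /hK[H H0 hH] : ~ satf (join (fun=> 0) f) e p by move/hp.
apply: h; exists (fun c => H (lp c) (rp c)) => e' he'.
have -> : rows (fun c => H (lp c) (rp c)) = H; last exact: hH.
by apply/funext => j; apply/funext => i; rewrite /rows lpK rpK.
Qed.

(* [Q y x] says that the tree of [y] is simulated by the tree of [x], [P y x] that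
   the tree of [x] is not simulated by a proper subtree of that of [y].  For a
   well-founded tree of [x] these agree, and no ordinal rank is needed. *)
Lemma pi_norm (A : nat -> Prop) : Pi (fun g e => A (e 0)) ->
  exists P Q : nat -> nat -> Prop,
  [/\ Pi (fun g e => P (e 0) (e 1)), Sg (fun g e => Q (e 0) (e 1)) &
  [/\ forall x y, A x -> (P y x <-> Q y x),
      forall x y, A x -> Q y x -> A y,
      forall x y, A x -> A y -> Q x y \/ Q y x &
      forall x y z, Q x y -> Q y z -> Q x z]].
Proof.
move=> /pi_tree[k [d hA]].
have hch := ar_child k d.
set ch := child k d in hch hA.
(* A simulation is a relation between nodes, coded as the zero set of [h] on pairs, so that [LE] is
   one existential function quantifier over an arithmetical matrix. *)
pose LE x u y v := exists h : nat -> nat,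
  (forall a b a', h (pr a b) = 0 -> ch x a' a -> exists b', ch y b' b /\ h (pr a' b') = 0) /\
  h (pr u v) = 0.
have LEI (H : nat -> nat -> Prop) x y u v :
    (forall a b a', H a b -> ch x a' a -> exists b', ch y b' b /\ H a' b') ->
    H u v -> LE x u y v.
  move=> hH Huv; exists (fun c => if `[< H (lp c) (rp c) >] then 0 else 1).
  split; last by rewrite lpK rpK; case: asboolP.
  move=> a b a'; rewrite lpK rpK; case: asboolP => // /hH h _ /h[b' [? ?]].
  by exists b'; split=> //; rewrite lpK rpK; case: asboolP.
have LEE x u y v u' : LE x u y v -> ch x u' u -> exists v', ch y v' v /\ LE x u' y v'.
  by move=> [h [h1 h2]] /(h1 _ _ _ h2)[v' [? ?]]; exists v'; split=> //; exists h.
have LEtr x u y v z w : LE x u y v -> LE y v z w -> LE x u z w.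
  move=> h1 h2; apply: (LEI (fun a c => exists b, LE x a y b /\ LE y b z c)); last by exists v.
  move=> a c a' [b [h h']] /(LEE _ _ _ _ _ h)[b' [/(LEE _ _ _ _ _ h')[c' [? ?]] ?]].
  by exists c'; split=> //; exists b'.
have LEch x u u' : ch x u' u -> LE x u' x u.
  move=> cu; apply: (LEI (fun a b => ch x a b)) => // a b a' ab a'a.
  by exists a.
have LES x u y v : (forall u', ch x u' u -> exists v', ch y v' v /\ LE x u' y v') -> LE x u y v.
  move=> h; apply: (LEI (fun a b => (a = u /\ b = v) \/ LE x a y b)); last by left.
  move=> a b a' [[-> ->]|h'] ca.
    by have [v' [? ?]] := h _ ca; exists v'; split=> //; right.
  by have [v' [? ?]] := LEE _ _ _ _ _ h' ca; exists v'; split=> //; right.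
pose LT x u y v := exists v', ch y v' v /\ LE x u y v'.
(* Only one of the two trees has to be well-founded, so that [P] and [Q] can be compared at [x] in
   [A] for arbitrary [y]. *)
have tot x u y v : Acc (ch y) v -> LE x u y v \/ LT y v x u.
  move=> hv; elim: hv u => {}v _ IH u.
  have [|/(contra_not (LES x u y v))] := EM (LE x u y v); first by left.
  move=> /existsNP[u' /not_implyP[cu hu']]; right; exists u'; split=> //.
  apply: LES => v' cv; have [h|//] := IH _ cv u'.
  by case: hu'; exists v'.
have irr x u : Acc (ch x) u -> LT x u x u -> False.
  elim=> {}u _ IH [u' [cu h]]; apply: (IH u' cu).
  by have [v' [? ?]] := LEE _ _ _ _ _ h cu; exists v'.
have accLE x u y v : Acc (ch y) v -> LE x u y v -> Acc (ch x) u.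
  move=> hv; elim: hv u => {}v _ IH u h; constructor => u' cu.
  by have [v' [cv h']] := LEE _ _ _ _ _ h cu; apply: IH cv _ h'.
exists (fun y x => ~ LT x root y root), (fun y x => LE y root x root).
split.
- by rewrite /LT /LE; pi_auto.
- by rewrite /LE; pi_auto.
split.
- move=> x y /hA ax; split; first by have [] := tot y root x root ax.
  move=> h [y' [cy h']]; have [x' [cx h'']] := LEE _ _ _ _ _ h cy.
  by apply: irr ax _; exists x'; split=> //; apply: LEtr h' h''.
- by move=> x y /hA ax h; apply/hA; apply: accLE ax h.
- move=> x y /hA ax /hA ay; have [h|[x' [cx h]]] := tot x root y root ay; first by left.
  by right; apply: LEtr h (LEch _ _ _ cx).
- by move=> x y z; apply: LEtr.
Qed.

(** * Strings as numbers *)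

Definition dec_str (n : nat) : str := projT1 (cid (code_surj n)).

Lemma dec_strK n : code (dec_str n) = n.
Proof. by rewrite /dec_str; case: cid. Qed.

Lemma code_strK s : dec_str (code s) = s.
Proof. by apply: code_inj; rewrite dec_strK. Qed.

Lemma code_size s : 2 ^ size s <= (code s).+1 < 2 ^ (size s).+1.
Proof. by elim: s => //= b s IH; rewrite !expnS in IH *; case: b; lia. Qed.

Lemma code_cat s t : code (s ++ t) = code s + 2 ^ size s * code t.
Proof. by elim: s => /= [|b s ->]; rewrite ?expnS; [lia|nia]. Qed.

(** The power is used in place of the length: two inequalities read it off the code, and its inverse
    is the measure of the cylinder. *)
Definition len_pow (n : nat) : nat := 2 ^ size (dec_str n).
Definition pre (m n : nat) : bool := prefix (dec_str m) (dec_str n).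
Definition incomparable (m n : nat) : Prop := ~ pre m n /\ ~ pre n m.

Lemma len_pow_gt0 n : 0 < len_pow n.
Proof. by rewrite expn_gt0. Qed.

Definition pow2 (p : nat) : Prop := exists k, p = 2 ^ k.

(** Exponentiation is not in the language, but the powers of 2 are the positive numbers all of whose
    divisors are 1 or even. *)
Lemma ar_pow2 t : Fn t -> Ar (fun g e => pow2 (t g e)).
Proof.
apply: ar1.
apply: (@ar_iff (fun g e => 0 < e 0 /\
  forall d q, e 0 = d * q -> d = 1 \/ exists m, d = m + m)).
  move=> g e; split; last first.
    move=> [k ->]; split; first by rewrite expn_gt0.
    move=> d q dq; have /(dvdn_pfactor _ _ (isT : prime 2))[[|j] _ ->] : d %| 2 ^ k.
    - by rewrite dq dvdn_mulr.
    - by left.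
    - by right; exists (2 ^ j); rewrite expnS; lia.
  move=> [p0]; elim/ltn_ind: (e 0) p0 => p IH p0 h.
  have [p1|[m pm]] := h p 1 (esym (muln1 p)); first by exists 0.
  have [| |d q mdq|k km] := IH m; try lia.
    by have [||] := h d (q + q); [lia|left|right].
  by exists k.+1; rewrite expnS -km; lia.
ar_auto.
Qed.

(* The strings of length [l] have the codes from [2 ^ l - 1] to [2 ^ l.+1 - 2]. *)
Lemma len_powP n p : len_pow n = p <-> [/\ pow2 p, p <= n.+1 & n.+1 < p + p].
Proof.
have := code_size (dec_str n); rewrite dec_strK => /andP[h1 h2].
split=> [<-|[[k ->]] h3 h4].
  by split; [exists (size (dec_str n))|exact: h1|move: h2; rewrite expnS /len_pow; lia].
rewrite /len_pow; congr (2 ^ _); set l := size _ in h1 h2 *.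
have lt a b : 2 ^ a < 2 ^ b -> a < b by rewrite ltn_exp2l.
have /lt : 2 ^ l < 2 ^ k.+1 by rewrite expnS; lia.
have /lt : 2 ^ k < 2 ^ l.+1 by rewrite expnS in h2 *; lia.
by lia.
Qed.

Lemma fn_len_pow t : Fn t -> Fn (fun g e => len_pow (t g e)).
Proof.
apply: fn1; apply: (@ar_iff (fun g e => pow2 (e 0) /\ (e 0 <= (e 1).+1 /\ (e 1).+1 < e 0 + e 0))).
  by move=> g e; rewrite len_powP; split=> [[? []]|[]].
by apply: ar_and; [apply: ar_pow2|]; ar_auto.
Qed.

(** The first bit of a string is the least significant digit of its code, so the codes of the
    extensions of [m] form an arithmetic progression with step [len_pow m]. *)
Lemma preP m n : pre m n <-> exists u, n = m + len_pow m * u.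
Proof.
split=> [/prefixP[u hu]|[u hu]].
  by exists (code u); rewrite -{1}(dec_strK n) hu code_cat dec_strK.
rewrite /pre; apply/prefixP; exists (dec_str u); apply: code_inj.
by rewrite code_cat !dec_strK.
Qed.

Lemma ar_pre t u : Fn t -> Fn u -> Ar (fun g e => pre (t g e) (u g e)).
Proof.
apply: (@ar2 (fun a b => pre a b)).
apply: (@ar_iff (fun g e => exists u, e 1 = e 0 + len_pow (e 0) * u)).
  by move=> g e; rewrite preP.
apply: ar_ex; apply: ar_eq; first exact: fn_var.
by apply: fn_add; [exact: fn_var|apply: fn_mul; [apply: fn_len_pow|]; exact: fn_var].
Qed.

Lemma ar_incomparable t u : Fn t -> Fn u -> Ar (fun g e => incomparable (t g e) (u g e)).
Proof. by move=> ht hu; apply: ar_and; apply: ar_not; apply: ar_pre. Qed.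

Lemma fn_exp2 t : Fn t -> Fn (fun g e => 2 ^ t g e).
Proof.
apply: fn1; apply: (@ar_iff (fun g e => exists a b, beta a b 0 = 1 /\
   ((forall i, i < e 1 -> beta a b i.+1 = 2 * beta a b i) /\ beta a b (e 1) = e 0))).
  move=> g e; split=> [[a [b [b0 [bS <-]]]]|<-].
    suff -> : forall i, i <= e 1 -> beta a b i = 2 ^ i by [].
    elim=> [|i IH] hi; first by rewrite b0.
    by rewrite bS// IH ?expnS// ltnW.
  have [a [b hab]] := beta_seq (fun i => 2 ^ i) (e 1).+1.
  exists a, b; split; first by rewrite hab.
  by split=> [i hi|]; rewrite !hab ?expnS//; lia.
by ar_auto.
Qed.

Ltac fn_atom ::=
  match goal with
  | |- Fn (fun g e => pr _ _) => apply: fn_pr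
  | |- Fn (fun g e => lp _) => apply: fn_lp
  | |- Fn (fun g e => rp _) => apply: fn_rp
  | |- Fn (fun g e => beta _ _ _) => apply: fn_beta
  | |- Fn (fun g e => len_pow _) => apply: fn_len_pow
  | |- Fn (fun g e => 2 ^ _) => apply: fn_exp2
  end.
Ltac ar_atom ::=
  match goal with
  | |- Ar (fun g e => is_true (pre _ _)) => apply: ar_pre
  | |- Ar (fun g e => incomparable _ _) => apply: ar_incomparable
  | |- Ar (fun g e => pow2 _) => apply: ar_pow2
  end.

Definition cy (n : nat) : set cantor := cylinder (dec_str n).
Definition union_cy (R : nat -> Prop) : set cantor := \bigcup_(n in [set n | R n]) cy n.

Lemma cyP n X : cy n X <-> dec_str n = mkseq X (size (dec_str n)).
Proof.
rewrite /cy /cylinder /initial /=; split=> [h|h i hi].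
  apply: (@eq_from_nth _ false); first by rewrite size_mkseq.
  by move=> i hi; rewrite nth_mkseq// h.
by rewrite h nth_mkseq.
Qed.

Lemma mkseq_take (X : cantor) m n : m <= n -> take m (mkseq X n) = mkseq X m.
Proof.
move=> mn; apply: (@eq_from_nth _ false); rewrite size_take_min !size_mkseq; first lia.
by move=> i hi; rewrite nth_take ?nth_mkseq//; lia.
Qed.

Lemma cy_mkseq n m X : cy n X -> size (dec_str n) <= m -> prefix (dec_str n) (mkseq X m).
Proof. by move=> /cyP h hm; rewrite prefixE mkseq_take// -h. Qed.

Lemma cy_code X m : cy (code (mkseq X m)) X.
Proof. by apply/cyP; rewrite code_strK size_mkseq. Qed.
Arguments cy_code : clear implicits.

Lemma pre_cy m n : pre m n -> cy n `<=` cy m.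
Proof.
move=> /prefixP[u hu] X /cyP h; apply/cyP.
have := congr1 (take (size (dec_str m))) h; rewrite mkseq_take; last by rewrite hu size_cat leq_addr.
by rewrite {1}hu take_size_cat.
Qed.

Lemma pre_refl n : pre n n.
Proof. exact: prefix_refl. Qed.

Lemma pre_trans m n k : pre m n -> pre n k -> pre m k.
Proof. exact: prefix_trans. Qed.

Lemma cy_comp m n X : cy m X -> cy n X -> pre m n \/ pre n m.
Proof.
move=> hm hn; have [h|/ltnW h] := leqP (size (dec_str m)) (size (dec_str n)).
  by left; rewrite /pre {1}(cyP n X).1//; exact: cy_mkseq.
by right; rewrite /pre {1}(cyP m X).1//; exact: cy_mkseq.
Qed.

Lemma pre_size m n : pre m n -> size (dec_str m) <= size (dec_str n).
Proof. by move=> /prefixP[u ->]; rewrite size_cat leq_addr. Qed.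

Lemma pre_eq m n : pre m n -> size (dec_str n) <= size (dec_str m) -> m = n.
Proof.
move=> /prefixP[u hu]; rewrite hu size_cat -[leqRHS]addn0 leq_add2l leqn0 => /nilP u0.
by apply: (can_inj dec_strK); rewrite hu u0 cats0.
Qed.

Lemma cy_pre_ex m n X : cy m X -> cy n X -> size (dec_str m) <= size (dec_str n) -> pre m n.
Proof.
move=> hm hn h; have [//|hnm] := cy_comp hm hn.
by rewrite (pre_eq hnm h) pre_refl.
Qed.

(** These strings are a prefix-free generator of the same open set. They serve measure estimates
    only, so no definability is claimed for them. *)
Definition minimal (R : nat -> Prop) (n : nat) : Prop := R n /\ forall m, pre m n -> R m -> m = n.

Lemma minimal_ex (R : nat -> Prop) n : R n -> exists2 m, minimal R m & pre m n.
Proof.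
move: {2}(size (dec_str n)) (leqnn (size (dec_str n))) => k.
elim: k n => [|k IH] n hk Rn.
  exists n; rewrite ?pre_refl//; split=> // m hm _; apply: pre_eq => //; lia.
have [h|/existsNP[m /not_implyP[hm /not_implyP[Rm mn]]]] := EM (forall m, pre m n -> R m -> m = n).
  by exists n; rewrite ?pre_refl.
have [|m' hm' pm'] := IH m _ Rm.
  rewrite leqNgt; apply/negP => h; apply: mn; apply: pre_eq => //; lia.
by exists m' => //; apply: pre_trans pm' hm.
Qed.

Lemma minimal_incomparable R m n : minimal R m -> minimal R n -> m <> n -> incomparable m n.
Proof.
by move=> [Rm hm] [Rn hn] mn; split=> [/hn|/hm] h; apply: mn; rewrite h.
Qed.

Lemma union_cy_minimal R : union_cy (minimal R) = union_cy R.
Proof.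
apply/seteqP; split=> X [n /= Rn Xn]; first by exists n => //; case: Rn.
by have [m ? mn] := minimal_ex Rn; exists m => //; apply: pre_cy Xn.
Qed.

(** * The measure of higher open sets *)

Definition pull (R : realType) (A : set cantor) : set R :=
  `[0%R, 1%R[ `&` @binary_digits R @^-1` A.
Arguments pull : clear implicits.
Definition lmeasurable (R : realType) (A : set cantor) : Prop := measurable (pull R A).
Definition lam (R : realType) (A : set cantor) : R := fine (lambda R A).

Definition upto (D : nat -> Prop) (F : nat -> set cantor) (N : nat) : set cantor :=
  \bigcup_(n in [set n | D n /\ n < N]) F n.

Section lam_theory.
Local Open Scope ring_scope.
Variable R : realType.
Implicit Types A B : set cantor.

Lemma lmeasurable_bigcup (D : set nat) F : (forall n, D n -> lmeasurable R (F n)) ->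
  lmeasurable R (\bigcup_(n in D) F n).
Proof.
by move=> h; rewrite /lmeasurable /pull preimage_bigcup setI_bigcupr; apply: bigcup_measurable => n /h.
Qed.

Lemma lmeasurable_bigcap (F : nat -> set cantor) : (forall n, lmeasurable R (F n)) ->
  lmeasurable R (\bigcap_n F n).
Proof.
move=> h; rewrite /lmeasurable /pull preimage_bigcap.
have -> : `[0, 1[ `&` \bigcap_i (@binary_digits R @^-1` F i) =
    \bigcap_i (pull R (F i)).
  apply/seteqP; split=> x; first by move=> [x01 hx] i _; split=> //; exact: hx.
  by move=> hx; split=> [|i _]; [have [] := hx 0 I|have [] := hx i I].
by apply: bigcapT_measurable => n; exact: h.
Qed.

Lemma lmeasurableU A B : lmeasurable R A -> lmeasurable R B -> lmeasurable R (A `|` B).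
Proof. by move=> hA hB; rewrite /lmeasurable /pull preimage_setU setIUr; apply: measurableU. Qed.

Lemma lmeasurableI A B : lmeasurable R A -> lmeasurable R B -> lmeasurable R (A `&` B).
Proof. by move=> hA hB; rewrite /lmeasurable /pull preimage_setI setIIr; apply: measurableI. Qed.

Lemma lmeasurableD A B : lmeasurable R A -> lmeasurable R B -> lmeasurable R (A `\` B).
Proof.
move=> hA hB; rewrite /lmeasurable.
have -> : pull R (A `\` B) = pull R A `\` pull R B.
  by apply/seteqP; split=> x /=; rewrite /pull /=; tauto.
exact: measurableD.
Qed.

Lemma lmeasurable_cy n : lmeasurable R (cy n).
Proof.
rewrite /lmeasurable; suff -> : pull R (cy n) = `[0, 1[ `&` [set x | (bval (dec_str n))%:R / 2 ^+ size (dec_str n) <= x <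
    (bval (dec_str n)).+1%:R / 2 ^+ size (dec_str n)].
  apply: measurableI => //.
  have -> : [set x : R | (bval (dec_str n))%:R / 2 ^+ size (dec_str n) <= x <
    (bval (dec_str n)).+1%:R / 2 ^+ size (dec_str n)] = `[(bval (dec_str n))%:R / 2 ^+ size (dec_str n),
      (bval (dec_str n)).+1%:R / 2 ^+ size (dec_str n)[%classic.
    by apply/seteqP; split=> x /=; rewrite in_itv.
  exact: measurable_itv.
apply/seteqP; split=> x [] /=; rewrite in_itv /= => x01 h; split=> //;
  rewrite -?in_itv//; move: h; rewrite ler_pdivrMr ?ltr_pdivlMr ?exprn_gt0//.
  move=> /(initial_binary_digits _ x01) <-; apply: truncn_itv.
  by rewrite mulr_ge0 ?exprn_ge0//; case/andP: x01.
by move=> h; apply/(initial_binary_digits _ x01); exact: truncn_def.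
Qed.

Lemma lmeasurable_union_cy D : lmeasurable R (union_cy D).
Proof. by apply: lmeasurable_bigcup => n _; exact: lmeasurable_cy. Qed.

Lemma lambda_setT : lambda R setT = 1%E.
Proof.
have := @lambda_cylinder R [::]; rewrite expr0 invr1 => <-.
by congr (lambda R _); apply/seteqP; split=> // X _ i.
Qed.

Lemma lambda_le A B : lmeasurable R A -> lmeasurable R B -> A `<=` B -> (lambda R A <= lambda R B)%E.
Proof.
move=> hA hB AB; apply: le_measure; rewrite ?inE//.
by move=> x [? /AB].
Qed.

Lemma lmeasurableT : lmeasurable R setT.
Proof. by rewrite /lmeasurable /pull preimage_setT setIT; exact: measurable_itv. Qed.

Lemma lamE A : lmeasurable R A -> lambda R A = (lam R A)%:E.
Proof.
move=> hA; rewrite /lam fineK// ge0_fin_numE; last exact: measure_ge0.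
by apply: le_lt_trans (lambda_le hA lmeasurableT _) _ => //; rewrite lambda_setT ltry.
Qed.

Lemma lam_ge0 A : 0 <= lam R A.
Proof. by apply: fine_ge0; exact: measure_ge0. Qed.

Lemma lam_mono A B : lmeasurable R A -> lmeasurable R B -> A `<=` B -> lam R A <= lam R B.
Proof. by move=> hA hB AB; rewrite -lee_fin -!lamE//; exact: lambda_le. Qed.

Lemma lam_le1 A : lmeasurable R A -> lam R A <= 1.
Proof.
move=> hA; rewrite -lee_fin -lamE//; have /le_trans : (lambda R A <= lambda R setT)%E.
  by apply: lambda_le => //; exact: lmeasurableT.
by apply; rewrite lambda_setT.
Qed.

Lemma lam_cy n : lam R (cy n) = (len_pow n)%:R^-1.
Proof. by rewrite /lam /cy lambda_cylinder /= /len_pow natrX. Qed.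

Lemma lam0 : lam R set0 = 0.
Proof. by rewrite /lam /lambda preimage_set0 setI0 measure0. Qed.

Lemma lamU A B : lmeasurable R A -> lmeasurable R B -> A `&` B = set0 ->
  lam R (A `|` B) = lam R A + lam R B.
Proof.
move=> hA hB AB; apply: EFin_inj; rewrite EFinD -!lamE//; last exact: lmeasurableU.
rewrite /lambda preimage_setU setIUr measureU//.
by rewrite -setIIr -preimage_setI AB preimage_set0 setI0.
Qed.

Lemma lamU_le A B : lmeasurable R A -> lmeasurable R B -> lam R (A `|` B) <= lam R A + lam R B.
Proof.
move=> hA hB; rewrite -lee_fin EFinD -!lamE//; last exact: lmeasurableU.
by rewrite /lambda preimage_setU setIUr; exact: measureU2.
Qed.

Lemma lam_up (F : nat -> set cantor) (c : R) : (forall n, lmeasurable R (F n)) ->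
  (forall m n, (m <= n)%N -> F m `<=` F n) -> (forall n, lam R (F n) <= c) ->
  lam R (\bigcup_n F n) <= c.
Proof.
move=> hF ndF hc; have hU : lmeasurable R (\bigcup_n F n) by exact: lmeasurable_bigcup.
rewrite -lee_fin -lamE//.
have : (@lebesgue_measure R) \o (fun n => pull R (F n)) @ \oo --> lebesgue_measure (\bigcup_n pull R (F n)).
  apply: nondecreasing_cvg_mu => //; first exact: bigcupT_measurable.
  by move=> m n mn; apply/subsetPset => x [? ?]; split=> //; apply: ndF mn _ _.
have -> : \bigcup_n pull R (F n) = pull R (\bigcup_n F n).
  by rewrite /pull preimage_bigcup setI_bigcupr.
move=> h; rewrite -[lambda _ _](cvg_lim _ h)//; apply: lime_le.
  by apply/cvg_ex; eexists; exact: h.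
by near=> n; rewrite /= -[lebesgue_measure _]/(lambda R (F n)) lamE// lee_fin.
Unshelve. all: by end_near. Qed.

(** Continuity from below, applied to the complements inside [F 0]. *)
Lemma lam_down (F : nat -> set cantor) (c : R) : (forall n, lmeasurable R (F n)) ->
  (forall m n, (m <= n)%N -> F n `<=` F m) -> lambda R (\bigcap_n F n) = 0%E -> 0 < c ->
  exists n, lam R (F n) <= c.
Proof.
move=> hF niF h0 c0; apply: contrapT => /forallNP h.
have {}h n : c < lam R (F n) by rewrite ltNge; apply/negP.
pose G n := F 0%N `\` F n.
have hG n : lmeasurable R (G n) by exact: lmeasurableD.
have hI : lmeasurable R (\bigcap_n F n) by exact: lmeasurable_bigcap.
have hGF n : lam R (G n) + lam R (F n) = lam R (F 0%N).
  rewrite -lamU//; first congr lam.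
    by rewrite /G setUC setDUK//; apply: niF.
  by rewrite /G setDKI.
have : lam R (\bigcup_n G n) <= lam R (F 0%N) - c.
  apply: lam_up => // [m n mn x [? ?]|n]; first by split=> // /(niF _ _ mn).
  by have := hGF n; have := h n; lra.
have hU : lmeasurable R (\bigcup_n G n) by exact: lmeasurable_bigcup.
have : lam R (F 0%N) <= lam R (\bigcup_n G n) + lam R (\bigcap_n F n).
  apply: le_trans (lamU_le hU hI); apply: lam_mono => //; first exact: lmeasurableU.
  move=> x Fx; have [h'|/existsNP[n hn]] := EM (forall n, F n x); first by right.
  by left; exists n.
by rewrite [X in _ + X]/lam h0 /=; lra.
Qed.

Lemma lmeasurable_upto D F N : (forall n, D n -> lmeasurable R (F n)) -> lmeasurable R (upto D F N).
Proof. by move=> h; apply: lmeasurable_bigcup => n [/h]. Qed.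

Lemma upto0 D F : upto D F 0 = set0.
Proof. by rewrite /upto; apply/seteqP; split=> // X [n [_]]. Qed.

Lemma uptoS D F N : D N -> upto D F N.+1 = upto D F N `|` F N.
Proof.
move=> dN; apply/seteqP; split=> X.
  move=> [n [dn]]; rewrite ltnS leq_eqVlt => /orP[/eqP ->|nN] hX; first by right.
  by left; exists n.
by move=> [[n [dn nN] hX]|hX]; [exists n => //; split=> //; exact: ltnW|exists N].
Qed.

Lemma uptoSn D F N : ~ D N -> upto D F N.+1 = upto D F N.
Proof.
move=> dN; apply/seteqP; split=> X [n [dn nN] hX]; exists n => //; split=> //; last exact: ltnW.
by move: nN; rewrite ltnS leq_eqVlt => /orP[/eqP nN|//]; rewrite nN in dn.
Qed.

Lemma bigcup_upto D F : \bigcup_(n in [set n | D n]) F n = \bigcup_N upto D F N.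
Proof.
apply/seteqP; split=> X; first by move=> [n dn hX]; exists n.+1 => //; exists n.
by move=> [N _ [n [dn _] hX]]; exists n.
Qed.

Lemma upto_mono D F m n : (m <= n)%N -> upto D F m `<=` upto D F n.
Proof. by move=> mn X [k [dk km] hX]; exists k => //; split=> //; exact: leq_trans km mn. Qed.

Lemma lam_bigcup_le D F (c : R) : (forall n, D n -> lmeasurable R (F n)) ->
  (forall N, lam R (upto D F N) <= c) -> lam R (\bigcup_(n in [set n | D n]) F n) <= c.
Proof.
move=> hF hc; rewrite bigcup_upto; apply: lam_up => //.
  by move=> N; exact: lmeasurable_upto.
exact: upto_mono.
Qed.

Lemma lam_upto_disj D F N : (forall n, D n -> lmeasurable R (F n)) ->
  (forall m n, D m -> D n -> m <> n -> F m `&` F n = set0) ->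
  lam R (upto D F N) = \sum_(n < N | `[< D n >]) lam R (F n).
Proof.
move=> hF dF; elim: N => [|N IH]; first by rewrite upto0 lam0 big_ord0.
rewrite big_mkcond big_ord_recr -big_mkcond /=; case: asboolP => dN; last first.
  by rewrite uptoSn// addr0.
rewrite uptoS// lamU ?IH//; [exact: lmeasurable_upto|exact: hF|].
apply/seteqP; split=> // X [[n [dn nN] hX] hX'].
by rewrite -(dF n N)//; move=> nN'; rewrite nN' ltnn in nN.
Qed.

Lemma lam_upto_sub D F N : (forall n, D n -> lmeasurable R (F n)) ->
  lam R (upto D F N) <= \sum_(n < N | `[< D n >]) lam R (F n).
Proof.
move=> hF; elim: N => [|N IH]; first by rewrite upto0 lam0 big_ord0.
rewrite big_mkcond big_ord_recr -big_mkcond /=; case: asboolP => dN; last first.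
  by rewrite uptoSn// addr0.
rewrite uptoS//; apply: le_trans (lamU_le _ _) _; [exact: lmeasurable_upto|exact: hF|].
by rewrite lerD2r.
Qed.

Lemma incomparable_cy m n : incomparable m n -> cy m `&` cy n = set0.
Proof.
by move=> [h1 h2]; apply/seteqP; split=> // X [h3 h4]; have [] := cy_comp h3 h4.
Qed.

(** Over the minimal strings both the cylinders and the sets [B n] are disjoint, so [k] times the
    measure of the cylinders is at most the sum of the $\lambda(B_n)$, which is at most 1. This
    bounds the test against [X]. *)
Lemma lam_union_cy_mul (D : nat -> Prop) (B : nat -> set cantor) (k : R) : 0 <= k ->
  (forall n, D n -> lmeasurable R (B n)) ->
  (forall m n, incomparable m n -> B m `&` B n = set0) ->
  (forall n, D n -> k / (len_pow n)%:R <= lam R (B n)) -> k * lam R (union_cy D) <= 1.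
Proof.
move=> k0 hB dB hk; rewrite -union_cy_minimal.
have mD n : minimal D n -> D n by case.
have [->|kn0] := eqVneq k 0; first by rewrite mul0r.
have kp : 0 < k by rewrite lt_def kn0.
rewrite mulrC -ler_pdivlMr// div1r; apply: lam_bigcup_le => [n _|N]; first exact: lmeasurable_cy.
rewrite -div1r ler_pdivlMr// mulrC.
have dc m n : minimal D m -> minimal D n -> m <> n -> cy m `&` cy n = set0.
  by move=> hm hn mn; apply: incomparable_cy; exact: minimal_incomparable hm hn mn.
have dB' m n : minimal D m -> minimal D n -> m <> n -> B m `&` B n = set0.
  by move=> hm hn mn; apply: dB; exact: minimal_incomparable hm hn mn.
rewrite lam_upto_disj//; last by move=> n _; exact: lmeasurable_cy.
rewrite mulr_sumr.
apply: (@le_trans _ _ (\sum_(n < N | `[< minimal D n >]) lam R (B n))).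
  by apply: ler_sum => n /asboolP /mD dn; rewrite lam_cy; exact: hk.
rewrite -lam_upto_disj//; last by move=> n /mD; exact: hB.
by apply: lam_le1; apply: lmeasurable_upto => n /mD; exact: hB.
Qed.

(** Subadditivity over a prefix-free generator. With [B n] the oracles whose output extends [n], it
    bounds the inverse image of an open set. *)
Lemma lam_cover_le (D : nat -> Prop) (B : nat -> set cantor) (k : R) : 0 <= k ->
  (forall n, D n -> lmeasurable R (B n)) ->
  (forall n, D n -> lam R (B n) <= k / (len_pow n)%:R) ->
  lam R (\bigcup_(n in [set n | minimal D n]) B n) <= k * lam R (union_cy D).
Proof.
move=> k0 hB hk; have mD n : minimal D n -> D n by case.
apply: lam_bigcup_le => [n /mD|N]; first exact: hB.
apply: le_trans (lam_upto_sub _ _) _ => [n /mD|]; first exact: hB.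
apply: (@le_trans _ _ (k * lam R (upto (minimal D) cy N))).
  rewrite lam_upto_disj; last 2 first.
  - by move=> n _; exact: lmeasurable_cy.
  - by move=> m n hm hn mn; apply: incomparable_cy; exact: minimal_incomparable hm hn mn.
  rewrite mulr_sumr; apply: ler_sum => n /asboolP /mD dn.
  by rewrite lam_cy; exact: hk.
apply: ler_wpM2l => //; apply: lam_mono.
- by apply: lmeasurable_upto => n _; exact: lmeasurable_cy.
- exact: lmeasurable_union_cy.
- by move=> X [n [/mD dn _] hX]; exists n.
Qed.

End lam_theory.

(** * Definability of comparisons between measures and rationals *)

Definition covers (D : nat -> Prop) (n : nat) : Prop := exists s, D s /\ pre s n.

(** For $q=2^L$ this counts the covered strings among the first [k] strings of length $L$, in the
    order of their codes. *)
Definition level (D : nat -> Prop) (q : nat) : nat -> nat :=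
  fun k => \sum_(v < k) `[< covers D (q.-1 + v) >].

Section lam_definable.
Local Open Scope ring_scope.
Variable R : realType.

Definition union_cy_le (D : nat -> Prop) (L : nat) : set cantor :=
  union_cy (fun s => D s /\ (size (dec_str s) <= L)%N).

Lemma lam_union_cy_le (D : nat -> Prop) (L : nat) :
  lam R (union_cy_le D L) = (level D (2 ^ L) (2 ^ L))%:R / (2 ^ L)%:R.
Proof.
set q := (2 ^ L)%N.
have q0 : (0 < q)%N by rewrite expn_gt0.
have sz v : (v < q)%N -> size (dec_str (q.-1 + v)) = L.
  move=> vq; have : len_pow (q.-1 + v) = q.
    by apply/len_powP; split; [exists L|lia|lia].
  by rewrite /len_pow => /eqP; rewrite eqn_exp2l// => /eqP.
pose D' v := (v < q)%N /\ covers D (q.-1 + v).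
have -> : union_cy_le D L = upto D' (fun v => cy (q.-1 + v)) q.
  apply/seteqP; split=> X.
    move=> [s /= [Ds sL] hs]; pose n := code (mkseq X L).
    have := code_size (mkseq X L); rewrite size_mkseq expnS -/q -/n => /andP[h1 h2].
    have hn : (q.-1 + (n.+1 - q) = n)%N by lia.
    exists (n.+1 - q)%N; last by rewrite hn; exact: cy_code.
    split; last by lia.
    split; first by lia.
    by exists s; split=> //; rewrite hn /pre code_strK; exact: cy_mkseq.
  move=> [v [[vq [s [Ds hs]]] _] hX]; exists s => /=; last exact: pre_cy hX.
  by split=> //; rewrite -(sz v vq); exact: pre_size.
rewrite lam_upto_disj; last 2 first.
- by move=> n _; exact: lmeasurable_cy.
- move=> m n [mq _] [nq _] mn; apply: incomparable_cy; split=> h; apply: mn.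
    by have := pre_eq h; rewrite !sz// => /(_ (leqnn _)); lia.
  by have := pre_eq h; rewrite !sz// => /(_ (leqnn _)); lia.
rewrite big_mkcond /level natr_sum mulr_suml; apply: eq_bigr => v _.
have -> : `[< D' v >] = `[< covers D (q.-1 + v) >].
  by apply/asboolP/asboolP => [[]|] //; split.
case: asboolP => _; rewrite ?mul0r// mul1r lam_cy /len_pow sz//.
Qed.

(* The counting function of [covers D] is the least of the [f] considered; quantifying
   over all of them leaves [D] in a positive position. *)
Lemma lam_gtP (D : nat -> Prop) (a b : nat) : (0 < b)%N ->
  a%:R / b%:R < lam R (union_cy D) <->
  exists q, pow2 q /\ forall f : nat -> nat,
    (forall v, (v < q)%N -> (f v <= f v.+1)%N /\
      forall s w, w.+1 = (q + v)%N -> D s -> pre s w -> (f v < f v.+1)%N) ->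
    (a * q < b * f q)%N.
Proof.
move=> b0.
have key L : a%:R / b%:R < lam R (union_cy_le D L) <-> (a * 2 ^ L < b * level D (2 ^ L) (2 ^ L))%N.
  rewrite lam_union_cy_le ltr_pdivlMr ?ltr0n ?expn_gt0// mulrAC ltr_pdivrMr ?ltr0n//.
  by rewrite -!natrM ltr_nat mulnC [in X in (_ < X)%N]mulnC.
split=> [h|[q [[L qL] h]]].
  have [L /key hL] : exists L, a%:R / b%:R < lam R (union_cy_le D L).
    apply: contrapT => /forallNP h'.
    suff : lam R (union_cy D) <= a%:R / b%:R by rewrite leNgt h.
    have -> : union_cy D = \bigcup_L union_cy_le D L.
      apply/seteqP; split=> X; first by move=> [s Ds hs]; exists (size (dec_str s)) => //; exists s.
      by move=> [L _ [s [Ds _] hs]]; exists s.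
    apply: lam_up => [L|m n mn X [s [Ds sm] hs]|L]; first exact: lmeasurable_union_cy.
      by exists s => //; split=> //; exact: leq_trans sm mn.
    by rewrite leNgt; apply/negP.
  exists (2 ^ L)%N; split; first by exists L.
  move=> f hf; apply: leq_trans hL _; rewrite leq_mul2l; apply/orP; right.
  suff H k : (k <= 2 ^ L)%N -> (level D (2 ^ L) k <= f k)%N by exact: H.
  elim: k => [|k IH] kL; first by rewrite /level big_ord0.
  rewrite /level big_ord_recr /= -/(level D (2 ^ L) k).
  have [h1 h2] := hf k kL; have := IH (ltnW kL).
  case: asboolP => [[s [Ds hs]]|_]; last by rewrite addn0 => /leq_trans; apply.
  have := h2 s ((2 ^ L).-1 + k)%N _ Ds hs.
  have : (0 < 2 ^ L)%N by rewrite expn_gt0.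
  by move=> ? /(_ ltac:(lia)) ? ?; rewrite addn1; lia.
have /key hL : (a * 2 ^ L < b * level D (2 ^ L) (2 ^ L))%N.
  rewrite -qL; apply: h => v vq; rewrite /level big_ord_recr /=; split; first exact: leq_addr.
  move=> s w wq Ds sw; case: asboolP => [_|]; first by rewrite addn1.
  by case; exists s; split=> //; have -> : (q.-1 + v = w)%N by lia.
apply: lt_le_trans hL _; apply: lam_mono; [exact: lmeasurable_union_cy|exact: lmeasurable_union_cy|].
by move=> X [s [Ds _] hs]; exists s.
Qed.

(* As [lam_gtP], but counting the strings that are not covered, so that [D] occurs
   negatively. *)
Lemma lam_leP (D : nat -> Prop) (a b : nat) : (0 < b)%N ->
  lam R (union_cy D) <= a%:R / b%:R <->
  forall q, pow2 q -> forall f : nat -> nat,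
    (forall v, (v < q)%N -> (f v <= f v.+1)%N /\
      forall w, w.+1 = (q + v)%N -> (forall s, D s -> ~ pre s w) -> (f v < f v.+1)%N) ->
    (b * q <= a * q + b * f q)%N.
Proof.
move=> b0.
pose unc q k := (\sum_(v < k) ~~ `[< covers D (q.-1 + v) >])%N.
have uncE q k : (level D q k + unc q k = k)%N.
  rewrite /level /unc -big_split /=; under eq_bigr do rewrite addnC addn_negb.
  by rewrite sum1_card card_ord.
have key L : lam R (union_cy_le D L) <= a%:R / b%:R <-> (b * level D (2 ^ L) (2 ^ L) <= a * 2 ^ L)%N.
  rewrite lam_union_cy_le ler_pdivrMr ?ltr0n ?expn_gt0// mulrAC ler_pdivlMr ?ltr0n//.
  by rewrite -!natrM ler_nat mulnC [in X in (X <= _)%N]mulnC.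
split=> [h q [L ->] f hf|h].
  have /key hL : lam R (union_cy_le D L) <= a%:R / b%:R.
    apply: le_trans h; apply: lam_mono; [exact: lmeasurable_union_cy|exact: lmeasurable_union_cy|].
    by move=> X [s [Ds _] hs]; exists s.
  have H k : (k <= 2 ^ L)%N -> (unc (2 ^ L) k <= f k)%N.
    elim: k => [|k IH] kL; first by rewrite /unc big_ord0.
    rewrite /unc big_ord_recr /= -/(unc (2 ^ L)%N k).
    have [h1 h2] := hf k kL; have := IH (ltnW kL).
    case: asboolP => [_|nc]; first by rewrite addn0 => /leq_trans; apply.
    have := h2 ((2 ^ L).-1 + k)%N; have : (0 < 2 ^ L)%N by rewrite expn_gt0.
    move=> ? /(_ ltac:(lia)) /(_ _) h3 ?; rewrite addn1.
    suff : (f k < f k.+1)%N by lia.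
    by apply: h3 => s Ds hs; apply: nc; exists s.
  rewrite -{1}(uncE (2 ^ L)%N (2 ^ L)%N) mulnDr; apply: leq_add hL _.
  by rewrite leq_mul2l H// orbT.
have -> : union_cy D = \bigcup_L union_cy_le D L.
  apply/seteqP; split=> X; first by move=> [s Ds hs]; exists (size (dec_str s)) => //; exists s.
  by move=> [L _ [s [Ds _] hs]]; exists s.
apply: lam_up => [L|m n mn X [s [Ds sm] hs]|L]; first exact: lmeasurable_union_cy.
  by exists s => //; split=> //; exact: leq_trans sm mn.
apply/key.
have /h hu : pow2 (2 ^ L) by exists L.
have := hu (unc (2 ^ L)%N); move=> /(_ _) {}hu.
suff : (b * 2 ^ L <= a * 2 ^ L + b * unc (2 ^ L) (2 ^ L))%N.
  by rewrite -{1}(uncE (2 ^ L)%N (2 ^ L)%N) mulnDr leq_add2r.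
apply: hu => v vq; rewrite /unc big_ord_recr /=; split; first exact: leq_addr.
move=> w wq hw; case: asboolP => [[s [Ds hs]]|_]; last by rewrite addn1.
by case: (hw s Ds); have -> : (w = (2 ^ L).-1 + v)%N by lia.
Qed.

Lemma pi_fst P : Pi P -> Pi (fun g e => P (fst2 g) e).
Proof.
move=> [q hq qP]; exists (fun G e => q (join (fst2 (fst2 G)) (snd2 G)) e).
  apply: ar_subst hq fn_var _; apply: ff_join; first exact: ff_fst (ff_fst ff_id).
  exact: ff_snd ff_id.
by move=> g e; rewrite qP; split=> h f; move: (h f); rewrite fst2_join snd2_join.
Qed.

Lemma fn_fst t : Fn t -> Fn (fun g e => t (fst2 g) e).
Proof. by move=> ht; apply: (ar_subst ht fn_var); apply: ff_fst ff_id. Qed.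

(** In [lam_gtP] the set of strings stands in a premise of a premise, hence positively, so a
    $\Pi^1_1$ set gives a $\Pi^1_1$ statement. *)
Lemma pi_lam_gt (P : (nat -> nat) -> (nat -> nat) -> nat -> Prop) (a b : ctxf) :
  Pi (fun g e => P g (fun i => e i.+1) (e 0%N)) -> Fn a -> Fn b ->
  (forall g e, (0 < b g e)%N) ->
  Pi (fun g e => (a g e)%:R / (b g e)%:R < lam R (union_cy (P g e))).
Proof.
move=> hP ha hb b0.
apply: pi_iff => [g e|]; first by symmetry; apply: lam_gtP.
apply: pi_ex; apply: pi_and; first by apply: pi_of_ar; ar_auto.
apply: (@pi_fun (fun g e f => (forall v, (v < e 0)%N -> (f v <= f v.+1)%N /\
   forall s w, w.+1 = (e 0 + v)%N -> P g (fun i => e i.+1) s -> pre s w -> (f v < f v.+1)%N) ->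
   (a g (fun i => e i.+1) * e 0 < b g (fun i => e i.+1) * f (e 0))%N)).
(* Inside the matrix the bound numbers are [w], [s], [v], [q], from index 0 on; the original context
   starts at 4. *)
have h1 : Pi (fun g e => P (fst2 g) (fun i => e i.+4) (e 1%N)).
  apply: (@pi_env (fun g e => P (fst2 g) (fun i => e i.+1) (e 0%N))
    (fun g e => scons (e 1%N) (fun i => e i.+4))); last by case=> [|i]; exact: fn_var.
  exact: pi_fst hP.
have h2 : Fn (fun g e => a (fst2 g) (fun i => e i.+1)) by exact: fn_shift (fn_fst ha).
have h3 : Fn (fun g e => b (fst2 g) (fun i => e i.+1)) by exact: fn_shift (fn_fst hb).
by move: h1 h2 h3; rewrite /fst2 => h1 h2 h3; pi_auto.
Qed.

(** Dually, the set of strings stands negatively in [lam_leP] and has to be $\Sigma^1_1$. *)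
Lemma pi_lam_le (P : (nat -> nat) -> (nat -> nat) -> nat -> Prop) (a b : ctxf) :
  Sg (fun g e => P g (fun i => e i.+1) (e 0%N)) -> Fn a -> Fn b ->
  (forall g e, (0 < b g e)%N) ->
  Pi (fun g e => lam R (union_cy (P g e)) <= (a g e)%:R / (b g e)%:R).
Proof.
move=> hP ha hb b0.
apply: pi_iff => [g e|]; first by symmetry; apply: lam_leP.
apply: pi_all; apply: pi_imp; first by apply: sg_of_ar; ar_auto.
apply: (@pi_fun (fun g e f => (forall v, (v < e 0)%N -> (f v <= f v.+1)%N /\
   forall w, w.+1 = (e 0 + v)%N -> (forall s, P g (fun i => e i.+1) s -> ~ pre s w) ->
     (f v < f v.+1)%N) ->
   (b g (fun i => e i.+1) * e 0 <= a g (fun i => e i.+1) * e 0 + b g (fun i => e i.+1) * f (e 0))%N)).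
have h1 : Sg (fun g e => P (fst2 g) (fun i => e i.+4) (e 0%N)).
  apply: (@pi_env (fun g e => ~ P (fst2 g) (fun i => e i.+1) (e 0%N))
    (fun g e => scons (e 0%N) (fun i => e i.+4))); last by case=> [|i]; exact: fn_var.
  exact: pi_fst hP.
have h2 : Fn (fun g e => a (fst2 g) (fun i => e i.+1)) by exact: fn_shift (fn_fst ha).
have h3 : Fn (fun g e => b (fst2 g) (fun i => e i.+1)) by exact: fn_shift (fn_fst hb).
by move: h1 h2 h3; rewrite /fst2 => h1 h2 h3; pi_auto.
Qed.

End lam_definable.

(** * Thinning and cutting off a functional *)

(* A number [w] names the axiom with oracle string [lp w] and output string [rp w]. *)
Definition outputs (Psi : nat -> Prop) (s rho : nat) : Prop :=
  exists w, Psi w /\ (pre s (rp w) /\ lp w = rho).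

Lemma incomparable_sym m n : incomparable m n -> incomparable n m.
Proof. by case. Qed.

Lemma pre_comp m n k : pre m k -> pre n k -> pre m n \/ pre n m.
Proof.
move=> hm hn; pose Z i := nth false (dec_str k) i; have Zk : cy k Z by [].
exact: cy_comp (pre_cy hm Zk) (pre_cy hn Zk).
Qed.

Lemma incomparable_prer m n k : incomparable m n -> pre n k -> incomparable m k.
Proof.
move=> [h1 h2] nk; split=> h; last by apply: h2; apply: pre_trans nk h.
by have [] := pre_comp h nk.
Qed.

Lemma incomparable_pre m n k l : incomparable m n -> pre m k -> pre n l -> incomparable k l.
Proof.
move=> h mk nl; apply: incomparable_prer nl; apply: incomparable_sym.
by apply: incomparable_prer mk; exact: incomparable_sym.
Qed.

Section thinning.
Local Open Scope ring_scope.
Variable R : realType.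

(** The term is $1/(x+1)-1/(x+2)$, so the full sum telescopes. *)
Lemma sum_telescope N (D : nat -> bool) :
  \sum_(x < N | D x) (1 / (x.+1 * x.+2)%:R) <= 1 :> R.
Proof.
have H : \sum_(x < N) (1 / (x.+1 * x.+2)%:R) = 1 - N.+1%:R^-1 :> R.
  elim: N => [|N IH]; first by rewrite big_ord0 invr1 subrr.
  rewrite big_ord_recr /= IH natrM.
  have h1 : N.+1%:R != 0 :> R by rewrite pnatr_eq0.
  have h2 : N.+2%:R != 0 :> R by rewrite pnatr_eq0.
  have e : N.+2%:R = N.+1%:R + 1 :> R by rewrite natr1.
  rewrite e in h2 *; move: (N.+1%:R : R) h1 h2 => y h1 h2.
  by field; rewrite h1 h2.
rewrite big_mkcond /=; apply: (@le_trans _ _ (\sum_(x < N) (1 / (x.+1 * x.+2)%:R))).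
  by apply: ler_sum => x _; case: ifP => // _; rewrite divr_ge0.
by rewrite H gerBl invr_ge0.
Qed.

Lemma thinning (F : nat -> Prop) : Pi (fun g e => F (e 0%N)) ->
  exists Psi : nat -> Prop,
  [/\ Pi (fun g e => Psi (e 0%N)),
    exists B : nat -> set cantor, [/\ forall s, lmeasurable R (B s),
      forall s t, incomparable s t -> B s `&` B t = set0 &
      forall s, lam R (union_cy (outputs Psi s)) <= lam R (B s) + 1 / (len_pow s)%:R] &
    forall X Y, (forall x, F x -> cy (lp x) Y -> cy (rp x) X) ->
      forall x, F x -> cy (lp x) Y -> exists z, [/\ Psi z, cy (lp z) Y & rp z = rp x]].
Proof.
move=> hF; have [P [Q [hP hQ [PQ QF Qtot Qtr]]]] := pi_norm hF.
(* [Rs x N] generates W_x minus its part [y < N]; the weights [1 / (x.+1 * x.+2)]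
   sum to [1].  Avoiding the part [y < N] gets harder as [N] grows, so the union
   over all good [N] taken in [Out] is the set obtained from the least good [N]. *)
pose Rs x N t := (exists y, Q y x /\ (incomparable (rp y) (rp x) /\ pre (lp y) t)) /\
  (forall y, (y < N)%N -> P y x -> incomparable (rp y) (rp x) -> incomparable (lp y) t).
pose w (x : nat) := (x.+1 * x.+2 * len_pow (rp x))%N.
pose Good x N := lam R (union_cy (Rs x N)) <= 1%:R / (w x)%:R.
pose Out x rho := pre (lp x) rho /\ exists N, Good x N /\
  forall y, (y < N)%N -> Q y x -> incomparable (rp y) (rp x) -> incomparable (lp y) rho.
pose Psi z := exists x, F x /\ (rp x = rp z /\ Out x (lp z)).
have hQ2 t u : Fn t -> Fn u -> Sg (fun g e => Q (t g e) (u g e)) by exact: sg2.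
have hP2 t u : Fn t -> Fn u -> Pi (fun g e => P (t g e) (u g e)) by exact: pi2.
have hF1 t : Fn t -> Pi (fun g e => F (t g e)) by exact: pi1.
have hGood t u : Fn t -> Fn u -> Pi (fun g e => Good (t g e) (u g e)).
  apply: (@pi2 Good).
  apply: (@pi_lam_le R (fun g e => Rs (e 0%N) (e 1%N)) (fun _ _ => 1%N) (fun g e => w (e 0%N))).
  (* [Q] occurs positively in [Rs] and [P] negatively, so [Rs] is $\Sigma^1_1$, as [pi_lam_le]
     requires; this is why both forms of the norm appear. *)
  - by rewrite /Rs; pi_auto.
  - by ar_auto.
  - by rewrite /w; ar_auto.
  - by move=> g e; rewrite /w !muln_gt0 /= len_pow_gt0.
have hPsi : Pi (fun g e => Psi (e 0%N)) by rewrite /Psi /Out; pi_auto.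
pose D x := union_cy (Out x).
pose W x := union_cy (fun t => exists y, Q y x /\ (incomparable (rp y) (rp x) /\ lp y = t)).
have hD x : lmeasurable R (D x) by exact: lmeasurable_union_cy.
have hW x : lmeasurable R (W x) by exact: lmeasurable_union_cy.
exists Psi; split=> //.
  pose I s := fun x => F x /\ pre s (rp x).
  (* The oracles given an output extending [s] by a thinned axiom that no axiom below it
     contradicts. *)
  exists (fun s => \bigcup_(x in [set x | I s x]) (D x `\` W x)); split.
  - by move=> s; apply: lmeasurable_bigcup => x _; exact: lmeasurableD.
  - move=> s t st; apply/seteqP; split=> // X [[x [Fx sx] [Dx Wx]] [y [Fy ty] [Dy Wy]]].
    have xy : incomparable (rp x) (rp y) by exact: incomparable_pre st sx ty.
    have Dcy z : D z X -> cy (lp z) X by move=> [rho [hrho _] /(pre_cy hrho)].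
    (* Of two axioms that apply to the oracle with conflicting outputs, the lower one puts the
       oracle into the set [W] of the other. *)
    have [h|h] := Qtot x y Fx Fy.
      by apply: Wy; exists (lp x); [exists x|exact: Dcy].
    by apply: Wx; exists (lp y); [exists y; split=> //; split=> //; exact: incomparable_sym|exact: Dcy].
  - move=> s.
    have hE x : F x -> lam R (D x `&` W x) <= 1 / (w x)%:R.
      move=> Fx; have [[N GN]|nG] := EM (exists N, Good x N); last first.
        have -> : D x `&` W x = set0; last by rewrite lam0 divr_ge0.
        apply/seteqP; split=> // X [[rho [_ [N [GN _]]] _] _].
        by apply: nG; exists N.
      have exG : exists N, `[< Good x N >] by exists N; apply/asboolP.
      case: (ex_minnP exG) => N0 /asboolP G0 min0.
      apply: le_trans (_ : lam R (union_cy (Rs x N0)) <= _); last exact: G0.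
      apply: lam_mono; [exact: lmeasurableI|exact: lmeasurable_union_cy|].
      move=> X [[rho [_ [N' [GN' hN']]] Xrho] [_ [y [Qy [iy <-]]] Xy]].
      (* A prefix of the oracle long enough to extend both [rho] and the string of the contradicting
         axiom. *)
      pose m := (size (dec_str rho) + size (dec_str (lp y)))%N.
      have Xm := cy_code X m.
      exists (code (mkseq X m)) => //; split.
        exists y; split=> //; split=> //; apply: cy_pre_ex Xy Xm _.
        by rewrite code_strK size_mkseq leq_addl.
      move=> y' y'N /(PQ _ _ Fx) Qy' iy'; apply: (@incomparable_prer _ rho).
        apply: hN' => //; apply: leq_trans y'N _; apply: min0; exact/asboolP.
      by apply: cy_pre_ex Xrho Xm _; rewrite code_strK size_mkseq leq_addr.
    pose U1 := \bigcup_(x in [set x | I s x]) (D x `\` W x).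
    pose U2 := \bigcup_(x in [set x | I s x]) (D x `&` W x).
    have mU1 : lmeasurable R U1 by apply: lmeasurable_bigcup => x _; exact: lmeasurableD.
    have mU2 : lmeasurable R U2 by apply: lmeasurable_bigcup => x _; exact: lmeasurableI.
    apply: (@le_trans _ _ (lam R (U1 `|` U2))).
      apply: lam_mono; [exact: lmeasurable_union_cy|exact: lmeasurableU|].
      move=> X [_ [z [[x [Fx [xz Ox]]] [sz <-]]] Xz].
      have Dx : D x X by exists (lp z).
      have Ix : I s x by split=> //; rewrite xz.
      by have [Wx|nWx] := EM (W x X); [right|left]; exists x.
    apply: le_trans (lamU_le mU1 mU2) _; rewrite lerD2l.
    apply: lam_bigcup_le => [x _|N]; first exact: lmeasurableI.
    apply: le_trans (lam_upto_sub _ _) _ => [x _|]; first exact: lmeasurableI.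
    apply: (@le_trans _ _ (\sum_(x < N | `[< I s x >]) (1 / (x.+1 * x.+2)%:R / (len_pow s)%:R))).
      apply: ler_sum => x /asboolP[Fx sx]; apply: le_trans (hE _ Fx) _.
      rewrite /w natrM invfM mulrA ler_pM2l; last by rewrite divr_gt0.
      rewrite lef_pV2 ?posrE ?ltr0n ?len_pow_gt0// ler_nat leq_exp2l//.
      exact: pre_size.
    rewrite -mulr_suml ler_pM2r ?invr_gt0 ?ltr0n ?len_pow_gt0//.
    exact: (sum_telescope N (fun x => `[< I s x >])).
move=> X Y hXY x Fx Yx.
have nW y : Q y x -> incomparable (rp y) (rp x) -> ~ cy (lp y) Y.
  move=> Qy [i1 i2] Yy; have h1 := hXY _ Fx Yx.
  have h2 := hXY _ (QF _ _ Fx Qy) Yy.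
  by have [] := cy_comp h2 h1.
(* The sets generated by [Rs x N] decrease to the empty set: an oracle put into them by [y] leaves
   at the latest at [N = y.+1]. *)
have [N GN] : exists N, Good x N.
  apply: lam_down.
  - by move=> N; exact: lmeasurable_union_cy.
  - move=> m n mn Z [t [h1 h2] Zt]; exists t => //; split=> // y ym.
    by apply: h2; exact: leq_trans ym mn.
  - have -> : \bigcap_n union_cy (Rs x n) = set0; last by rewrite /lambda preimage_set0 setI0 measure0.
    apply/seteqP; split=> // Z hZ.
    have [t [[y [Qy [iy yt]]] _] Zt] := hZ 0%N I.
    have [t' [_ h] Zt'] := hZ y.+1 I.
    have [i1 i2] := h y (leqnn _) ((PQ _ _ Fx).2 Qy) iy.
    by have [] := cy_comp (pre_cy yt Zt) Zt'.
  - by rewrite divr_gt0// ltr0n /w !muln_gt0 len_pow_gt0.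
(* At this length each [lp y] with [y < N] is either a prefix of the initial segment of [Y] or
   incomparable with it. *)
pose m := (size (dec_str (lp x)) + \sum_(y < N) size (dec_str (lp y)))%N.
have Ym := cy_code Y m.
exists (pr (code (mkseq Y m)) (rp x)); split; rewrite ?rpK ?lpK//.
exists x; rewrite ?rpK ?lpK; split=> //; split=> //; split.
  by apply: cy_pre_ex Yx Ym _; rewrite code_strK size_mkseq leq_addr.
exists N; split=> // y yN Qy iy.
have yn : ~ pre (lp y) (code (mkseq Y m)).
  by move=> h; apply: (nW y) => //; exact: pre_cy h _ Ym.
split=> // h; apply: yn; have -> : code (mkseq Y m) = lp y; last exact: pre_refl.
apply: pre_eq h _; rewrite code_strK size_mkseq /m (bigD1 (Ordinal yN))//=.
by rewrite addnCA leq_addr.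
Qed.

(** The test of [z] looks only at the $\Sigma^1_1$ set of axioms below [z], which keeps [Psi']
    within $\Pi^1_1$. *)
Lemma cutoff (Psi : nat -> Prop) (c : nat) : Pi (fun g e => Psi (e 0%N)) ->
  exists Psi' : nat -> Prop,
  [/\ Pi (fun g e => Psi' (e 0%N)),
    forall s, lam R (union_cy (outputs Psi' s)) <= c%:R / (len_pow s)%:R &
    forall z, Psi z ->
      (forall s, pre s (rp z) -> lam R (union_cy (outputs Psi s)) <= c%:R / (len_pow s)%:R) -> Psi' z].
Proof.
move=> hF; have [P [Q [hP hQ [PQ QF Qtot Qtr]]]] := pi_norm hF.
pose below z s rho := outputs (fun w => Q w z) s rho.
pose Psi' z := Psi z /\ forall s, pre s (rp z) -> lam R (union_cy (below z s)) <= c%:R / (len_pow s)%:R.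
have hQ2 t u : Fn t -> Fn u -> Sg (fun g e => Q (t g e) (u g e)) by exact: sg2.
have hb t u : Fn t -> Fn u ->
    Pi (fun g e => lam R (union_cy (below (t g e) (u g e))) <= c%:R / (len_pow (u g e))%:R).
  apply: (@pi2 (fun z s => lam R (union_cy (below z s)) <= c%:R / (len_pow s)%:R)).
  apply: (@pi_lam_le R (fun g e => below (e 0%N) (e 1%N)) (fun _ _ => c) (fun g e => len_pow (e 1%N))).
  - by rewrite /below /outputs; pi_auto.
  - by exact: fn_const.
  - by ar_auto.
  - by move=> g e; exact: len_pow_gt0.
exists Psi'; split.
- by rewrite /Psi'; pi_auto.
- move=> s; pose I w := Psi' w /\ pre s (rp w).
  have -> : union_cy (outputs Psi' s) = \bigcup_(w in [set w | I w]) cy (lp w).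
    apply/seteqP; split=> X; first by move=> [_ [w [? [? <-]]] ?]; exists w.
    by move=> [w [? ?] ?]; exists (lp w) => //; exists w.
  apply: lam_bigcup_le => [w _|N]; first exact: lmeasurable_cy.
  have c0 : 0 <= c%:R / (len_pow s)%:R :> R by rewrite divr_ge0.
  (* The kept axioms with code below [N] have a member [z] of largest norm; all of them lie below
     it, so the test of [z] at [s] bounds their union. *)
  have : (forall w, (w < N)%N -> ~ I w) \/
      exists2 z, I z & forall w, (w < N)%N -> I w -> Q w z.
    elim: N => [|N IH]; first by left.
    have [IN|nIN] := EM (I N); last first.
      case: IH => [h|[z Iz hz]].
        by left=> v; rewrite ltnS leq_eqVlt => /orP[/eqP ->//|/h].
      by right; exists z => // v; rewrite ltnS leq_eqVlt => /orP[/eqP ->//|/hz].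
    have FN : Psi N by have [[]] := IN.
    have QNN : Q N N by have [] := Qtot N N FN FN.
    case: IH => [h|[z Iz hz]]; right.
      exists N => // v; rewrite ltnS leq_eqVlt => /orP[/eqP ->//|/h] //.
    have Fz : Psi z by have [[]] := Iz.
    have [zN|Nz] := Qtot z N Fz FN.
      exists N => // v; rewrite ltnS leq_eqVlt => /orP[/eqP ->//|vN] Iv.
      exact: Qtr (hz _ vN Iv) zN.
    by exists z => // v; rewrite ltnS leq_eqVlt => /orP[/eqP ->//|/hz].
  case=> [h|[z [[Fz hz] sz] h]].
    have -> : upto I (fun w => cy (lp w)) N = set0; last by rewrite lam0.
    by apply/seteqP; split=> // X [w [Iw /h]].
  apply: le_trans (hz s sz); apply: lam_mono; last 1 first.
  - move=> X [w [Iw wN] Xw]; exists (lp w) => //; exists w; split; first exact: h.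
    by split=> //; case: Iw.
  - by apply: lmeasurable_upto => w _; exact: lmeasurable_cy.
  - exact: lmeasurable_union_cy.
- move=> z Fz hz; split=> // s sz; apply: le_trans (hz s sz).
  apply: lam_mono; [exact: lmeasurable_union_cy|exact: lmeasurable_union_cy|].
  move=> X [rho [w [Qw h]] Xr]; exists rho => //; exists w; split=> //.
  exact: QF Fz Qw.
Qed.

End thinning.

(** * Passage between [Pi11] and [Pi], and the theorem *)

Lemma pi_sat p (E : ctxF) : (forall i, Fn (fun g e => E g e i)) ->
  Pi (fun g e => forall f, satf f (E g e) p).
Proof.
move=> hE; exists (fun G e => satf (snd2 G) (E (fst2 G) e) p).
  by apply: ar_satf; [move=> i; exact: (fn_fst (hE i))|exact: ff_snd ff_id].
by move=> g e; split=> h f; move: (h f); rewrite fst2_join snd2_join.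
Qed.

Lemma sat_pi (P : (nat -> nat) -> Prop) : Pi (fun _ e => P e) ->
  exists p, forall s, P (nth 0 s) <-> forall f, sat f s p.
Proof.
move=> [q [p hp] hq]; exists p => s; split=> [h f|h].
  (* Every [f] is a join of a parameter, on which [P] does not depend, with the function quantified
     in [Pi]. *)
  rewrite satfE -hp -(join_eta f); move: (snd2 f); exact/hq.
by apply/(hq (fun=> 0)) => f; rewrite hp -satfE.
Qed.

Lemma uniform_openP U : uniform_higher_open U ->
  exists b : nat -> nat -> Prop, Pi (fun g e => b (e 0) (e 1)) /\ forall n, U n = union_cy (b n).
Proof.
move=> [B [[p hp] hU]]; exists (fun n s => B n (dec_str s)); split.
  apply: pi_iff (@pi_sat p (fun g e => nth 0 [:: e 0; e 1]) _) => [g e|i].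
    have := hp (e 0, dec_str (e 1)); rewrite /enc_nat_str /= dec_strK => ->.
    by split=> h f; have /satfE := h f.
  by case: i => [|[|i]] /=; rewrite ?nth_nil; [exact: fn_var|exact: fn_var|exact: fn_const].
move=> n; rewrite hU; apply/seteqP; split=> X.
  by move=> [s Bs Xs]; exists (code s); rewrite /= ?/cy code_strK.
by move=> [s Bs Xs]; exists (dec_str s).
Qed.

Lemma uniform_open_union_cy (b : nat -> nat -> Prop) : Pi (fun g e => b (e 0) (e 1)) ->
  uniform_higher_open (fun n => union_cy (b n)).
Proof.
move=> hb; exists (fun n => [set s | b n (code s)]); split.
  have [p hp] := @sat_pi (fun e => b (e 0) (e 1)) hb.
  by exists p => -[n s] /=; exact: (hp [:: n; code s]).
move=> n; apply/seteqP; split=> X.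
  by move=> [s bs Xs]; exists (dec_str s) => //=; rewrite dec_strK.
by move=> [s bs Xs]; exists (code s) => //; rewrite /cy code_strK.
Qed.

Lemma pi_axioms Phi : Pi11 enc_str_str Phi ->
  Pi (fun g e => Phi (dec_str (lp (e 0)), dec_str (rp (e 0)))).
Proof.
move=> [p hp].
apply: pi_iff (@pi_sat p (fun g e => nth 0 [:: lp (e 0); rp (e 0)]) _) => [g e|i].
  rewrite hp /enc_str_str /= !dec_strK.
  by split=> h f; have /satfE := h f.
by case: i => [|[|i]] /=; rewrite ?nth_nil; ar_auto.
Qed.

Theorem theorem1p2 (R : realType) (X Y : nat -> bool) :
  higher_ML_random R X ->
  higher_ML_random R Y ->
  higher_Turing_le X Y ->
  strongly_Pi11_ML_random R Y ->
  strongly_Pi11_ML_random R X.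
Proof.
move=> mlX _ [Phi [hPhi PhiY]] sY U hU U0 XU.
pose F x := Phi (dec_str (lp x), dec_str (rp x)).
have hF : Pi (fun g e => F (e 0)) := pi_axioms hPhi.
have FXY x : F x -> cy (lp x) Y -> cy (rp x) X.
  move=> Fx Yx i hi.
  have : fun_app Phi Y (i, nth false (dec_str (rp x)) i).
    by exists (dec_str (lp x), dec_str (rp x)).
  by rewrite PhiY => /= ->.
have FX s : cy s X -> exists x, [/\ F x, cy (lp x) Y & pre s (rp x)].
  (* An axiom that yields the bit of [X] at position $|s|$ has an output longer than [s]; this
     output is a prefix of [X] and so extends [s]. *)
  move=> Xs; have : fun_app Phi Y (size (dec_str s), X (size (dec_str s))) by rewrite PhiY.
  move=> [[tau sigma] [Phits tauY] [/= hs _]].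
  have Fx : F (pr (code tau) (code sigma)) by rewrite /F lpK rpK !code_strK.
  have Yx : cy (lp (pr (code tau) (code sigma))) Y by rewrite lpK /cy code_strK.
  exists (pr (code tau) (code sigma)); split=> //.
  apply: cy_pre_ex Xs (FXY _ Fx Yx) _.
  by rewrite rpK code_strK ltnW.
have [Psi [hPsi [B [hB dB lB]] PsiXY]] := thinning R hF.
have hPsi1 t : Fn t -> Pi (fun g e => Psi (t g e)) by exact: pi1.
have [n hn] : exists n, forall s, cy s X ->
    (lam R (union_cy (outputs Psi s)) <= (2 ^ n + 1)%:R / (len_pow s)%:R)%R.
  pose G n s := ((2 ^ n + 1)%:R / (len_pow s)%:R < lam R (union_cy (outputs Psi s)))%R.
  have hG : Pi (fun g e => G (e 0) (e 1)).
    apply: (@pi_lam_gt R (fun g e => outputs Psi (e 1)) (fun g e => 2 ^ e 0 + 1) (fun g e => len_pow (e 1))).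
    - by rewrite /outputs; pi_auto.
    - by ar_auto.
    - by ar_auto.
    - by move=> g e; exact: len_pow_gt0.
  have tG : higher_ML_test R (fun n => union_cy (G n)).
    split=> [|n]; first exact: uniform_open_union_cy.
    rewrite lamE ?lee_fin; last exact: lmeasurable_union_cy.
    have k0 : (0 < 2 ^+ n :> R)%R by rewrite exprn_gt0.
    rewrite -[leRHS]mul1r ler_pdivlMr// mulrC.
    apply: lam_union_cy_mul (ltW k0) _ dB _ => // s Gs.
    (* The summand 1 of $2^n+1$ absorbs the error of the thinning and leaves
       $\lambda(B_s)>2^n2^{-|s|}$. *)
    have := lt_le_trans Gs (lB s); rewrite natrD natrX mulrDl ltrD2r.
    exact: ltW.
  have := mlX _ tG; rewrite -existsNP => -[n /not_implyP[_ h]].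
  exists n => s Xs; rewrite leNgt; apply/negP => Gs; apply: h.
  by exists s.
set c := (2 ^ n + 1) in hn.
have [Psi' [hPsi' bPsi' Psi'z]] := cutoff R c hPsi.
have hPsi'1 t : Fn t -> Pi (fun g e => Psi' (t g e)) by exact: pi1.
have [b [hb Ub]] := uniform_openP hU.
have hb2 t u : Fn t -> Fn u -> Pi (fun g e => b (t g e) (u g e)) by exact: pi2.
(* Generators of the intersection of the first $n+1$ open sets. The sequence becomes decreasing, so
   its measures tend to 0. *)
pose b' n s := forall m, m <= n -> exists t, b m t /\ pre t s.
pose V n rho := exists s, b' n s /\ outputs Psi' s rho.
have hV : Pi (fun g e => V (e 0) (e 1)) by rewrite /V /b' /outputs; pi_auto.
have b'X k Z : (\bigcap_n U n) Z -> exists2 s, b' k s & cy s Z.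
  move=> ZU; elim: k => [|k [s hs Zs]].
    have := ZU 0 I; rewrite Ub => -[s bs Zs]; exists s => // m.
    by rewrite leqn0 => /eqP ->; exists s; rewrite pre_refl.
  have := ZU k.+1 I; rewrite Ub => -[t bt Zt].
  pose l := size (dec_str s) + size (dec_str t).
  have Zl := cy_code Z l; exists (code (mkseq Z l)) => // m.
  rewrite leq_eqVlt => /orP[/eqP ->|/hs[u [bu us]]].
    exists t; split=> //; apply: cy_pre_ex Zt Zl _.
    by rewrite code_strK size_mkseq leq_addl.
  exists u; split=> //; apply: pre_trans us _; apply: cy_pre_ex Zs Zl _.
  by rewrite code_strK size_mkseq leq_addr.
have b'0 : lambda R (\bigcap_n union_cy (b' n)) = 0%E.
  rewrite -U0; congr (lambda R _); apply/seteqP; split=> Z hZ k _.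
    have [s bs Zs] := hZ k I; have [t [bt ts]] := bs k (leqnn _).
    by rewrite Ub; exists t => //; exact: pre_cy ts _ Zs.
  by have [s bs Zs] := b'X k Z hZ; exists s.
have c0 : (0 < c%:R :> R)%R by rewrite ltr0n /c addn1.
have lV k : (lam R (union_cy (V k)) <= c%:R * lam R (union_cy (b' k)))%R.
  apply: le_trans (lam_cover_le (B := fun s => union_cy (outputs Psi' s)) _ _ _).
  - apply: lam_mono; [exact: lmeasurable_union_cy|by apply: lmeasurable_bigcup => s _; exact: lmeasurable_union_cy|].
    move=> Z [rho [s [bs [w [Pw [sw <-]]]]] Zr].
    (* An output extending [s] also extends the minimal prefix of [s], so the minimal strings
       suffice to cover the inverse image. *)
    have [s' ms' ss'] := minimal_ex bs.
    exists s' => //; exists (lp w) => //; exists w; split=> //; split=> //.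
    exact: pre_trans ss' sw.
  - exact: ltW.
  - by move=> s _; exact: lmeasurable_union_cy.
  - by move=> s _; exact: bPsi'.
apply: (sY (fun n => union_cy (V n))); first exact: uniform_open_union_cy.
  have mV : lmeasurable R (\bigcap_n union_cy (V n)).
    by apply: lmeasurable_bigcap => k; exact: lmeasurable_union_cy.
  rewrite lamE//; congr (_%:E); apply/eqP; rewrite eq_le lam_ge0 andbT.
  apply/ler_addgt0Pr => eps eps0; rewrite add0r.
  have [k hk] : exists k, (lam R (union_cy (b' k)) <= eps / c%:R)%R.
    apply: lam_down b'0 _; [by move=> k; exact: lmeasurable_union_cy| |by rewrite divr_gt0].
    move=> i j ij Z [s bs Zs]; exists s => // m mi.
    by apply: bs; exact: leq_trans mi ij.
  apply: (@le_trans _ _ (lam R (union_cy (V k)))).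
    by apply: lam_mono => //; [exact: lmeasurable_union_cy|move=> Z; apply].
  apply: le_trans (lV k) _; rewrite mulrC -ler_pdivlMr//.
move=> k _; have [s bs Xs] := b'X k X XU.
have [x [Fx Yx sx]] := FX s Xs.
have [z [Pz Yz zx]] := PsiXY X Y FXY x Fx Yx.
exists (lp z) => //; exists s; split=> //; exists z; split; last by rewrite zx.
(* The output of [z] is a prefix of [X], so all its prefixes obey the bound obtained from the
   randomness of [X], and the cutoff keeps [z]. *)
apply: Psi'z => // t; rewrite zx => tx; apply: hn.
exact: pre_cy tx _ (FXY _ Fx Yx).
Qed.
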